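(* Let $\mu \in \mathcal{T}_{-}$, $C\geq 2$, $s\in E(\mu)$ and $n\in \mathbb{N}_0$ with $n\ge 2C$. If $z,\lambda\in\mathbb{C}$ satisfy $|z-s|\le C/n$ and $|\lambda-s|\le C/n$, then $$\frac{1}{n+1} \left| \overline{w (s)}\, K_n(z, \lambda ) - D_n(z, \lambda ) \right| \leq e^{30C} L(\mu,s,n) .$$
   Context: $\mathbb{T}$ is the unit circle in $\mathbb{C}$, $\mathbb{N}_0=\{0,1,2,\dots\}$. For a function $g$ of a complex variable, $g^*(z):=\overline{g(\overline{z}^{-1})}$ (on $\mathbb{T}$ this is complex conjugation). A complex probability measure on $\mathbb{T}$ is a complex Borel measure $\mu$ with $\int_{\mathbb{T}}d\mu=1$. For polynomials $f,g$ put $\langle f,g\rangle_\mu:=\int_{\mathbb{T}} f g^*\,d\mu$. A polynomial $\Phi$ is left (right) orthogonal if $\langle \Phi,p\rangle_\mu=0$ (respectively $\langle p,\Phi\rangle_\mu=0$) for all polynomials $p$ of degree strictly less than that of $\Phi$. $\mathcal{T}$ is the class of complex probability measures $\mu$ on $\mathbb{T}$ such that for each $n\in\mathbb{N}_0$ there exist a unique left orthogonal monic polynomial $\Phi_n$ and a unique right orthogonal monic polynomial $\tilde\Phi_n$ of degree $n$. For $\mu\in\mathcal{T}$ there are unique complex numbers $F_{n+1},\tilde F_{n+1}$ ($n\in\mathbb{N}_0$) with $\Phi_{n+1}-z\Phi_n=\overline{F_{n+1}}z^n\tilde\Phi_n^*$ and $\tilde\Phi_{n+1}-z\tilde\Phi_n=\overline{\tilde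 F_{n+1}}z^n\Phi_n^*$. $\mathcal{T}_-$ is the class of $\mu\in\mathcal{T}$ with $F_n=-\tilde F_n$ for all $n\ge1$. For $\mu\in\mathcal{T}_-$ one has $\langle\Phi_n,\tilde\Phi_n\rangle_\mu=\prod_{j=1}^n(1+|F_j|^2)>0$, and the normalized polynomials are $\phi_n:=\Phi_n/\sqrt{\langle\Phi_n,\tilde\Phi_n\rangle_\mu}$, $\tilde\phi_n:=\tilde\Phi_n/\sqrt{\langle\Phi_n,\tilde\Phi_n\rangle_\mu}$. The kernels are $K_n(z,\lambda):=\sum_{j=0}^n\tilde\phi_j(z)\phi_j^*(\lambda)$ and $D_n(z,\lambda):=\sum_{j=0}^n z^j\lambda^{-j}$. Let $d|y|$ be arclength measure on $\mathbb{T}$ and let $\frac{w}{2\pi}$ be the Radon-Nikodym derivative of (the absolutely continuous part of) $\mu$ with respect to arclength. $E(\mu)$ is the set of all $s\in\mathbb{T}$ such that $s$ is not in the support of the singular part of $\mu$ and $s$ is a Lebesgue point of $\frac{w}{2\pi}$, in particular $|w(s)|<\infty$. For $s\in E(\mu)$ and $n\in\mathbb{N}_0$, $$L(\mu,s,n):=\int_{\mathbb{T}}\min\left\{n+1,\frac{1}{(n+1)|y-s|^2}\right\}\left|d\mu(y)-w(s)\frac{d|y|}{2\pi}\right|,$$ where the integration is against the total variation of the indicated complex measure. *)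

(* Defs.v *)
From HB Require Import structures.
From mathcomp Require Import all_boot all_order all_algebra complex.
From mathcomp Require Import all_classical all_reals all_analysis.
Set Implicit Arguments.
Unset Strict Implicit.
Unset Printing Implicit Defensive.
Import Order.TTheory GRing.Theory Num.Theory.
Import numFieldNormedType.Exports.
Import Normc.
Local Open Scope classical_set_scope.
Local Open Scope ring_scope.
Local Open Scope complex_scope.

Lemma normc_le_ReIm (R : rcfType) (z : R[i]) :
  normc z <= `|complex.Re z| + `|complex.Im z|.
Proof.
case: z => a b /=; rewrite -(@ler_pXn2r _ 2) ?nnegrE ?sqrtr_ge0 ?addr_ge0//.
rewrite sqr_sqrtr ?addr_ge0 ?sqr_ge0// sqrrD !real_normK ?num_real//.
by rewrite -addrA lerD2l ler_wpDl// mulrn_wge0// mulr_ge0.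
Qed.

Section complex_measure.
Context d (T : measurableType d) (R : realType).

(* A complex measure is the pair of its real and imaginary parts, which are   *)
(* finite signed measures.                                                    *)
Record complex_measure := ComplexMeasure {
  cm_Re : {charge set T -> \bar R} ;
  cm_Im : {charge set T -> \bar R} }.

Definition cm_val (nu : complex_measure) (A : set T) : R[i] :=
  fine (cm_Re nu A) +i* fine (cm_Im nu A).

Coercion cm_val : complex_measure >-> Funclass.

Definition cm_scale (c : R[i]) (m : {charge set T -> \bar R}) :=
  ComplexMeasure (cscale (complex.Re c) m) (cscale (complex.Im c) m).

Definition cm_sub (nu1 nu2 : complex_measure) :=
  ComplexMeasure (cadd (cm_Re nu1) (copp (cm_Re nu2)))
                 (cadd (cm_Im nu1) (copp (cm_Im nu2))).

Lemma hahn (nu : {charge set T -> \bar R}) :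
  {PN : set T * set T | hahn_decomposition nu PN.1 PN.2}.
Proof. by apply: cid; have [P [N PN]] := Hahn_decomposition nu; exists (P, N). Qed.

(* The Jordan decomposition does not depend on the chosen Hahn decomposition. *)
Definition charge_integral (nu : {charge set T -> \bar R}) (f : T -> R) : R :=
  \int[jordan_pos (svalP (hahn nu))]_x f x -
  \int[jordan_neg (svalP (hahn nu))]_x f x.

Definition cm_integral (nu : complex_measure) (f : T -> R[i]) : R[i] :=
  (charge_integral (cm_Re nu) (fun y => complex.Re (f y)) -
   charge_integral (cm_Im nu) (fun y => complex.Im (f y))) +i*
  (charge_integral (cm_Re nu) (fun y => complex.Im (f y)) +
   charge_integral (cm_Im nu) (fun y => complex.Re (f y))).

(* Finite disjoint families of measurable subsets of A give the same supremum *)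
(* as finite (or countable) measurable partitions when A is measurable, and a *)
(* non-negative value for every set A.                                        *)
Definition cm_variation (nu : complex_measure) (A : set T) : \bar R :=
  ereal_sup [set x | exists n (F : nat -> set T),
    [/\ forall k, measurable (F k), trivIset setT F, forall k, F k `<=` A
      & x = \sum_(k < n) (normc (nu (F k)))%:E]]%E.

Section cm_variation_measure.
Variable nu : complex_measure.
Local Open Scope ereal_scope.

Let cm_variation_ge (A : set T) n (F : nat -> set T) :
  (forall k, measurable (F k)) -> trivIset setT F -> (forall k, F k `<=` A) ->
  \sum_(k < n) (normc (nu (F k)))%:E <= cm_variation nu A.
Proof. by move=> mF tF FA; apply: ereal_sup_ubound; exists n, F. Qed.

Let normc_ge0 (z : R[i]) : (0 <= normc z)%R.
Proof. by case: z => a b; exact: sqrtr_ge0. Qed.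

Let cm_variation_ge0 (A : set T) : 0 <= cm_variation nu A.
Proof.
have := @cm_variation_ge A 0 (fun=> set0); rewrite big_ord0; apply => //.
- exact: trivIset_set0.
- by move=> _ t [].
Qed.

Let cm_variation0 : cm_variation nu set0 = 0.
Proof.
apply/eqP; rewrite eq_le cm_variation_ge0 andbT.
apply/ge_ereal_sup => _ [n [F [mF tF F0 ->]]].
rewrite big1// => k _; have -> : F k = set0 by rewrite -subset0; exact: F0.
by rewrite /cm_val !charge0/= expr0n/= addr0 sqrtr0.
Qed.

Let cm_variation_le (A B : set T) : A `<=` B -> cm_variation nu A <= cm_variation nu B.
Proof.
move=> AB; apply: ereal_sup_le => _ [n [F [mF tF FA ->]]].
by exists n, F; split => // k; exact: subset_trans AB.
Qed.

Let cm_variationU (A B : set T) : A `&` B = set0 ->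
  cm_variation nu A + cm_variation nu B <= cm_variation nu (A `|` B).
Proof.
move=> AB0; set V := cm_variation nu (A `|` B).
have [->|Vfin] := eqVneq V +oo; first exact: leey.
have {}Vfin : V \is a fin_num by rewrite ge0_fin_numE ?cm_variation_ge0// lt_neqAle Vfin leey.
suff H x : (exists n (F : nat -> set T),
    [/\ forall k, measurable (F k), trivIset setT F, forall k, F k `<=` A
      & x = \sum_(k < n) (normc (nu (F k)))%:E]) -> cm_variation nu B <= V - x.
  have Bfin : cm_variation nu B \is a fin_num.
    rewrite ge0_fin_numE ?cm_variation_ge0// (@le_lt_trans _ _ V)//.
      exact/cm_variation_le/subsetUr.
    by rewrite -ge0_fin_numE ?cm_variation_ge0.
  rewrite -leeBrDr//; apply/ge_ereal_sup => x Sx.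
  have := H _ Sx; case: Sx => n [F [_ _ _ ->]].
  by rewrite sumEFin leeBrDr// leeBrDr// addeC.
move=> [n [F [mF tF FA ->]]].
rewrite sumEFin; apply/ge_ereal_sup => _ [m [G [mG tG GB ->]]].
rewrite leeBrDr// -sumEFin addeC.
pose H k := if (k < n)%N then F k else G (k - n)%N.
have -> : \sum_(k < n) (normc (nu (F k)))%:E +
          \sum_(k < m) (normc (nu (G k)))%:E =
          \sum_(k < n + m) (normc (nu (H k)))%:E.
  rewrite big_split_ord/=; congr (_ + _); apply: eq_bigr => k _.
    by rewrite /H/= ltn_ord.
  by rewrite /H/= ltnNge leq_addr/= addKn.
apply: cm_variation_ge.
- by move=> k; rewrite /H; case: ifP.
- move=> i j _ _; rewrite /H.
  case: ifPn => iN; case: ifPn => jN [t [Ht1 Ht2]].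
  + by apply: tF => //; exists t.
  + have : (A `&` B) t by split; [exact: FA Ht1|exact: GB Ht2].
    by rewrite AB0.
  + have : (A `&` B) t by split; [exact: FA Ht2|exact: GB Ht1].
    by rewrite AB0.
  + have : (i - n = j - n)%N by apply: tG => //; exists t.
    by move: iN jN; rewrite -!leqNgt => ni nj /eqP; rewrite eqn_sub2rE// => /eqP.
- move=> k; rewrite /H; case: ifP => _.
  + by move=> t /FA; left.
  + by move=> t /GB; right.
Qed.

Let cm_variation_bigsetU (A : nat -> set T) n : trivIset setT A ->
  \sum_(0 <= i < n) cm_variation nu (A i) <= cm_variation nu (\big[setU/set0]_(i < n) A i).
Proof.
move=> tA; elim: n => [|n ih]; first by rewrite big_nil cm_variation_ge0.
rewrite big_nat_recr//= big_ord_recr/= (le_trans (leeD2r _ ih))//.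
apply: cm_variationU; rewrite -subset0 => t [+ Ant].
rewrite -bigcup_mkord => -[i /= ni Ait].
have ij : i = n by apply: tA => //; exists t.
by move: ni; rewrite ij ltnn.
Qed.

Let normc_sigma (A : nat -> set T) (G : set T) : (forall i, measurable (A i)) ->
  trivIset setT A -> measurable G -> G `<=` \bigcup_i A i ->
  (normc (nu G))%:E <= \sum_(0 <= i <oo) (normc (nu (G `&` A i)))%:E.
Proof.
move=> mA tA mG GA.
have GE : G = \bigcup_i (G `&` A i) by rewrite -setI_bigcupr; exact/esym/setIidPl.
have mGA i : measurable (G `&` A i) by exact: measurableI.
have tGA : trivIset setT (fun i => G `&` A i).
  by move=> i j _ _ [t [[_ Ait] [_ Ajt]]]; apply: tA => //; exists t.
have cvgc (c : {charge set T -> \bar R}) :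
    (\sum_(0 <= i < n) fine (c (G `&` A i)))%R @[n --> \oo] --> fine (c G).
  have : \sum_(0 <= i < n) c (G `&` A i) @[n --> \oo] --> c G.
    by rewrite {2}GE; apply: charge_semi_sigma_additive => //; rewrite -GE.
  rewrite -[X in _ --> X -> _](@fineK _ (c G)) ?fin_num_measure//.
  move/fine_cvg; apply: cvg_trans; apply: near_eq_cvg; near=> n => /=.
  by rewrite sum_fine// => i _; exact: fin_num_measure.
apply/lee_addgt0Pr => e e0.
have e2 : (0 < e / 2)%R by rewrite divr_gt0.
have /cvgrPdist_lt/(_ _ e2) HR := cvgc (cm_Re nu).
have /cvgrPdist_lt/(_ _ e2) HI := cvgc (cm_Im nu).
near \oo => n.
set S := \sum_(0 <= i <oo) _.
pose a := (\sum_(0 <= i < n) nu (G `&` A i))%R.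
have aE : a = (\sum_(0 <= i < n) fine (cm_Re nu (G `&` A i)))%R +i*
              (\sum_(0 <= i < n) fine (cm_Im nu (G `&` A i)))%R.
  rewrite /a; elim: (n) => [|k ih]; first by rewrite !big_nil.
  by rewrite !big_nat_recr//= ih.
have aS : (normc a)%:E <= S.
  apply: (@le_trans _ _ (\sum_(0 <= i < n) (normc (nu (G `&` A i)))%:E)); last first.
    by apply: nneseries_lim_ge => *; rewrite lee_fin.
  rewrite sumEFin lee_fin /a.
  elim: (n) => [|k ih]; first by rewrite !big_nil normc0.
  rewrite !big_nat_recr//= (le_trans (le_normcD _ _))//; exact: lerD.
have -> : nu G = (a + (nu G - a))%R by rewrite addrC subrK.
apply: (@le_trans _ _ ((normc a)%:E + (normc (nu G - a))%:E)).
  by rewrite -EFinD lee_fin; exact: le_normcD.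
apply: leeD => //; rewrite lee_fin (le_trans (normc_le_ReIm _))// aE/= [leRHS]splitr.
apply: lerD; apply: ltW.
- by near: n.
- by near: n.
Unshelve. all: by end_near. Qed.

Let cm_variation_sigma_additive : semi_sigma_additive (cm_variation nu).
Proof.
move=> A mA tA mUA.
have -> : cm_variation nu (\bigcup_i A i) = \sum_(0 <= i <oo) cm_variation nu (A i).
  apply/eqP; rewrite eq_le; apply/andP; split; last first.
    apply: lime_le; first by apply: is_cvg_nneseries => *; exact: cm_variation_ge0.
    near=> n; apply: (le_trans (cm_variation_bigsetU _ tA)).
    by apply: cm_variation_le; exact: bigsetU_bigcup.
  apply/ge_ereal_sup => _ [m [G [mG tG GA ->]]].
  apply: (@le_trans _ _
      (\sum_(j < m) \sum_(0 <= i <oo) (normc (nu (G j `&` A i)))%:E)).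
    by apply: lee_sum => j _; exact: normc_sigma.
  rewrite -nneseries_sum => [|i j _]; last by rewrite lee_fin.
  apply: lee_nneseries => [i _ _|i _]; first by apply: sume_ge0 => j _; rewrite lee_fin.
  apply: (@cm_variation_ge _ _ (fun j => G j `&` A i)).
  - by move=> k; exact: measurableI.
  - by move=> j k _ _ [t [[Gjt _] [Gkt _]]]; apply: tG => //; exists t.
  - by move=> k; exact: subIsetr.
by apply: is_cvg_nneseries => *; exact: cm_variation_ge0.
Unshelve. all: by end_near. Qed.

HB.instance Definition _ := isMeasure.Build _ T R (cm_variation nu)
  cm_variation0 cm_variation_ge0 cm_variation_sigma_additive.

End cm_variation_measure.
End complex_measure.

Section circle.
Variable R : realType.

Definition unit_circle : set R[i]^o := [set z | `|z| = 1].

Definition circle_pt : set_type unit_circle :=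
  exist _ (1 : R[i]) (mem_set (normr1 _)).

HB.instance Definition _ := isPointed.Build (set_type unit_circle) circle_pt.

(* The unit circle with its Borel sigma-algebra.                              *)
Definition circle := g_sigma_algebraType (@open (set_type unit_circle)).

HB.instance Definition _ := Measurable.on circle.
HB.instance Definition _ := Topological.on circle.

Lemma circle_open_measurable (U : set circle) : open U -> measurable U.
Proof. by move=> oU; exact: sub_sigma_algebra. Qed.

Definition circle_val (y : circle) : R[i] := set_val y.

Lemma cis_subproof (t : R) : (cos t +i* sin t) \in unit_circle.
Proof. by rewrite inE /unit_circle /= normc_def/= cos2Dsin2 sqrtr1. Qed.

Definition cis (t : measurableTypeR R) : circle :=
  exist _ (cos t +i* sin t) (cis_subproof t).

Lemma continuous_cis : continuous (cis : R -> set_type unit_circle).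
Proof.
apply: continuous_comp_initial => t.
apply/(@cvgrPdist_lt _ R[i]^o) => e e0.
have [Ie Re] : complex.Im e = 0 /\ 0 < complex.Re e.
  by case: e e0 => a b; rewrite ltcE/= => /andP[/eqP-> ->].
have e2 : 0 < complex.Re e / 2 by rewrite divr_gt0.
have /cvgrPdist_lt/(_ _ e2) Hc := @continuous_cos R t.
have /cvgrPdist_lt/(_ _ e2) Hs := @continuous_sin R t.
near=> u.
suff : normc ((cos t - cos u) +i* (sin t - sin u)) < complex.Re e.
  by rewrite ltcE Ie eqxx.
rewrite (le_lt_trans (normc_le_ReIm _))//= [ltRHS]splitr ltrD//.
- by near: u.
- by near: u.
Unshelve. all: by end_near. Qed.

Lemma measurable_cis : measurable_fun [set: measurableTypeR R] cis.
Proof.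
apply: (@measurability _ _ _ circle setT cis (@open (set_type unit_circle))) => //.
move=> _ [B oB <-]; rewrite setTI; apply: measurable_realfun.open_measurable.
by move/continuousP : continuous_cis; exact.
Qed.

Definition arclength : set circle -> \bar R :=
  pushforward
    (mrestr (@lebesgue_measure R) (measurable_itv `[0%R, 2 * pi[)) cis.

Let arclength0 : arclength set0 = 0%E.
Proof. by rewrite /arclength /pushforward preimage_set0 /mrestr set0I measure0. Qed.

Let arclength_ge0 A : (0 <= arclength A)%E.
Proof. exact: (@measure_ge0 _ _ _ lebesgue_measure). Qed.

Let arclength_sigma_additive : semi_sigma_additive arclength.
Proof.
move=> F mF tF mUF; rewrite /arclength /pushforward preimage_bigcup.
have mcF A : measurable A -> measurable (cis @^-1` A).
  by move=> mA; rewrite -[X in measurable X]setTI; exact: measurable_cis.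
apply: measure_semi_sigma_additive => [n||].
- exact: mcF.
- by move=> i j _ _ [t [/= Fit Fjt]]; apply: tF => //; exists (cis t).
- by rewrite -preimage_bigcup; exact: mcF.
Qed.

HB.instance Definition _ := isMeasure.Build _ circle R arclength
  arclength0 arclength_ge0 arclength_sigma_additive.

Let arclength_fin : fin_num_fun arclength.
Proof.
move=> A mA; rewrite ge0_fin_numE//.
apply: (@le_lt_trans _ _ (lebesgue_measure (`[0%R, 2 * pi[%classic : set R))).
  apply: le_measure; rewrite ?inE//=; apply: measurableI => //.
  by rewrite -[X in measurable X]setTI; exact: measurable_cis.
by rewrite lebesgue_measure_itv/=; case: ifP => _; rewrite -?EFinD ltry.
Qed.

HB.instance Definition _ :=
  @Measure_isFinite.Build _ _ _ arclength arclength_fin.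

Lemma arclengthT : arclength setT = (2 * pi)%:E.
Proof.
rewrite /arclength /pushforward /mrestr preimage_setT setTI.
by rewrite lebesgue_measure_itv/= lte_fin mulr_gt0 ?pi_gt0// EFinN sube0.
Qed.

End circle.

Section opuc.
Variable R : realType.
Implicit Types (mu nu : complex_measure (circle R) R) (f g p P : {poly R[i]}).

Definition pstar g (z : R[i]) : R[i] := (g.[(z^*%C)^-1])^*%C.

Definition ip mu f g : R[i] :=
  cm_integral mu (fun y : circle R => f.[circle_val y] * pstar g (circle_val y)).

(* size is degree + 1, and size 0 = 0.                                        *)
Definition left_orthogonal mu P :=
  forall p, (size p < size P)%N -> ip mu P p = 0.

Definition right_orthogonal mu P :=
  forall p, (size p < size P)%N -> ip mu p P = 0.

Definition left_mop mu n P :=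
  [/\ P \is monic, size P = n.+1 & left_orthogonal mu P].

Definition right_mop mu n P :=
  [/\ P \is monic, size P = n.+1 & right_orthogonal mu P].

Definition class_T mu :=
  mu setT = 1 /\
  forall n, (exists! P, left_mop mu n P) /\ (exists! P, right_mop mu n P).

(* Definite descriptions: the default 0 is irrelevant when mu is in class_T.  *)
Definition Phi mu n : {poly R[i]} := xget 0 [set P | left_mop mu n P].

Definition tPhi mu n : {poly R[i]} := xget 0 [set P | right_mop mu n P].

(* coefF mu n and coeftF mu n are the coefficients of index n.+1.  The        *)
(* recurrences are polynomial identities; z = 0 is excluded because the right-*)
(* hand side, evaluated pointwise with 0^-1 = 0, is not the polynomial there. *)
Definition coefF mu n : R[i] :=
  xget 0 [set F | forall z, z != 0 ->
    (Phi mu n.+1).[z] - z * (Phi mu n).[z] = F^*%C * z ^+ n * pstar (tPhi mu n) z].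

Definition coeftF mu n : R[i] :=
  xget 0 [set F | forall z, z != 0 ->
    (tPhi mu n.+1).[z] - z * (tPhi mu n).[z] = F^*%C * z ^+ n * pstar (Phi mu n) z].

Definition class_Tminus mu :=
  class_T mu /\ forall n, coefF mu n = - coeftF mu n.

Definition nphi mu n : {poly R[i]} :=
  (sqrtC (ip mu (Phi mu n) (tPhi mu n)))^-1 *: Phi mu n.

Definition ntphi mu n : {poly R[i]} :=
  (sqrtC (ip mu (Phi mu n) (tPhi mu n)))^-1 *: tPhi mu n.

Definition kernelK mu n (z lambda : R[i]) : R[i] :=
  \sum_(j < n.+1) (ntphi mu j).[z] * pstar (nphi mu j) lambda.

Definition kernelD n (z lambda : R[i]) : R[i] :=
  \sum_(j < n.+1) z ^+ j * lambda ^- j.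

Definition arclength_singular mu :=
  exists N : set (circle R),
    [/\ measurable N, arclength N = 0%E & cm_variation mu (~` N) = 0%E].

(* h is a version of the density, with respect to arclength, of the absolutely*)
(* continuous part of mu, and nu is the singular part of mu.                  *)
Definition lebesgue_decomposition mu (h : circle R -> R[i]) nu :=
  [/\ (@arclength R).-integrable setT (fun y => (complex.Re (h y))%:E),
      (@arclength R).-integrable setT (fun y => (complex.Im (h y))%:E),
      arclength_singular nu
    & forall A, measurable A ->
        mu A = ((\int[@arclength R]_(y in A) complex.Re (h y)) +i*
                (\int[@arclength R]_(y in A) complex.Im (h y))) + nu A].

Definition cm_support mu : set (circle R) :=
  [set s | forall U : set (circle R), open U -> U s -> cm_variation mu U != 0%E].

Definition circle_arc (s : circle R) (r : R) : set (circle R) :=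
  [set y | normc (circle_val y - circle_val s) < r].

Definition circle_lebesgue_pt (h : circle R -> R[i]) (s : circle R) :=
  ((arclength (circle_arc s r))^-1 *
   \int[@arclength R]_(y in circle_arc s r) (normc (h y - h s))%:E)%E
  @[r --> (0:R)^'+] --> 0%E.

Definition E_set (h : circle R -> R[i]) nu : set (circle R) :=
  [set s | ~ cm_support nu s /\ circle_lebesgue_pt h s].

(* Inversion is taken in \bar R, where 0^-1 = +oo: at y = s the integrand is  *)
(* n + 1.                                                                     *)
Definition functionalL mu (w : circle R -> R[i]) (s : circle R) (n : nat) :
    \bar R :=
  let dmu := cm_variation (cm_sub mu (cm_scale (w s / (2 * pi)%:C)
                         (charge_of_finite_measure (@arclength R)))) in
  (\int[dmu]_y mine n.+1%:R%:E
    (n.+1%:R * normc (circle_val y - circle_val s) ^+ 2)%:E^-1)%E.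

End opuc.

(* Main.v *)
Require Import Defs.
From mathcomp Require Import all_boot all_order all_algebra complex.
From mathcomp Require Import all_classical all_reals all_analysis.
From mathcomp Require Import measurable_realfun ring lra.
Set Implicit Arguments.
Unset Strict Implicit.
Unset Printing Implicit Defensive.
Import Order.TTheory GRing.Theory Num.Theory.
Import numFieldNormedType.Exports.
Import Normc.
Local Open Scope classical_set_scope.
Local Open Scope ring_scope.

(* The kernel K_n reproduces polynomials of degree at most n against mu, and  *)
(* D_n does so against normalized arclength. Hence the difference             *)
(* conj(w(s)) K_n(z, lambda) - D_n(z, lambda) is, up to sign and conjugation, *)
(* the integral over y of conj(K_n(z, y) D_n(y, lambda)) against the measure  *)
(* mu - w(s) |dy| / 2 pi, and it suffices to bound |K_n(z, y) D_n(y, lambda)| *)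
(* on the circle. When F_n = - tF_n the normalized Szego recurrence is a      *)
(* rotation for |z| = 1, so |phi_n|^2 and |tphi_n|^2 are at most 2 on the     *)
(* circle and at most 2 max(1, |z|)^(2n) elsewhere, whatever mu is.           *)
(* Summing gives |K_n| = O(n), and the Christoffel-Darboux formula gives      *)
(* |K_n(z, y)| = O(1 / |y - z|). The Dirichlet kernel D_n satisfies the same  *)
(* bounds.                                                                    *)

(** * Biorthogonal polynomials of a Toeplitz form *)

Section ReversedPolynomial.
Variable F : numClosedFieldType.
Implicit Types (f g : {poly F}) (z : F) (n : nat).

Definition revp n f : {poly F} := \poly_(i < n.+1) (f`_(n - i))^*.

Lemma size_revp n f : (size (revp n f) <= n.+1)%N.
Proof. exact: size_poly. Qed.

Lemma coef_revp n f i : (revp n f)`_i = if (i <= n)%N then (f`_(n - i))^* else 0.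
Proof. by rewrite coef_poly ltnS. Qed.

Lemma revpD n f g : revp n (f + g) = revp n f + revp n g.
Proof.
apply/polyP => i; rewrite coefD !coef_revp; case: ifP => _; last by rewrite addr0.
by rewrite coefD rmorphD.
Qed.

Lemma revpZ n c f : revp n (c *: f) = c^* *: revp n f.
Proof.
apply/polyP => i; rewrite coefZ !coef_revp; case: ifP => _; last by rewrite mulr0.
by rewrite coefZ rmorphM.
Qed.

Lemma revpK n f : (size f <= n.+1)%N -> revp n (revp n f) = f.
Proof.
move=> sf; apply/polyP => i; rewrite !coef_revp leq_subr; case: leqP => [ni|ni].
  by rewrite subKn// conjCK.
by rewrite nth_default// (leq_trans sf).
Qed.

Lemma revpS n f : (size f <= n.+1)%N -> revp n.+1 f = 'X * revp n f.
Proof.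
move=> sf; apply/polyP => -[|i]; rewrite coefXM !coef_revp/= ?ltnS ?subSS//.
by rewrite subn0 nth_default// conjC0.
Qed.

Lemma revpS_mulX n f : revp n.+1 ('X * f) = revp n f.
Proof.
apply/polyP => i; rewrite !coef_revp coefXM.
case: (ltngtP i n.+1) => [ni|ni|->].
- by rewrite -ltnS ni subn_eq0 leqNgt ni/= subSn.
- by rewrite leqNgt (ltn_trans _ ni).
- by rewrite subnn/= conjC0 ltnn.
Qed.

Lemma horner_revp n f z : z != 0 -> (size f <= n.+1)%N ->
  (revp n f).[z] = z ^+ n * (f.[(z^*)^-1])^*.
Proof.
move=> z0 sf; rewrite /revp horner_poly (horner_coef_wide _ sf) rmorph_sum mulr_sumr.
rewrite (reindex_inj rev_ord_inj)/=; apply: eq_bigr => i _.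
have iN : (i <= n)%N by rewrite -ltnS.
rewrite subSS subKn// rmorphM rmorphXn fmorphV/= conjCK mulrCA exprVn.
by rewrite exprB ?unitfE// -?ltnS.
Qed.

End ReversedPolynomial.

Lemma poly_eq_punctured (F : numDomainType) (p q : {poly F}) :
  (forall z, z != 0 -> p.[z] = q.[z]) -> p = q.
Proof.
move=> pq; apply/eqP; rewrite -subr_eq0; apply/negP => /negP pq0.
pose s := [seq i.+1%:R : F | i <- iota 0 (size (p - q)%R)].
have : (size s < size (p - q)%R)%N.
  apply: max_poly_roots => //.
    apply/allP => _ /mapP[i _ ->].
    by rewrite rootE hornerD hornerN pq ?subrr// pnatr_eq0.
  rewrite map_inj_uniq ?iota_uniq// => i j /eqP; rewrite eqr_nat => /eqP[].
  by [].
by rewrite size_map size_iota ltnn.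
Qed.

(* Both tfX and tf_revp say that B 'X^i 'X^j depends only on i - j. *)
Section ToeplitzForm.
Variable F : numClosedFieldType.
Implicit Types (f g p P Q : {poly F}) (c : F) (n : nat).

Record toeplitz_form (B : {poly F} -> {poly F} -> F) : Prop := ToeplitzForm {
  tfD : forall f g p, B (f + g) p = B f p + B g p ;
  tfZ : forall c f p, B (c *: f) p = c * B f p ;
  tfDr : forall f g p, B p (f + g) = B p f + B p g ;
  tfZr : forall c f p, B p (c *: f) = c^* * B p f ;
  tfX : forall f g, B ('X * f) ('X * g) = B f g ;
  tf_revp : forall n f g, (size f <= n.+1)%N -> (size g <= n.+1)%N ->
    B (revp n f) (revp n g) = B g f }.

Definition form_conj (B : {poly F} -> {poly F} -> F) f g := (B g f)^*.

Lemma toeplitz_form_conj B : toeplitz_form B -> toeplitz_form (form_conj B).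
Proof.
move=> tB; split => *; rewrite /form_conj.
- by rewrite (tfDr tB) rmorphD.
- by rewrite (tfZr tB) rmorphM/= conjCK.
- by rewrite (tfD tB) rmorphD.
- by rewrite (tfZ tB) rmorphM.
- by rewrite (tfX tB).
- by rewrite (tf_revp tB).
Qed.

Definition lmop (B : {poly F} -> {poly F} -> F) n P :=
  [/\ P \is monic, size P = n.+1 & forall p, (size p < size P)%N -> B P p = 0].

Definition rmop (B : {poly F} -> {poly F} -> F) n P :=
  [/\ P \is monic, size P = n.+1 & forall p, (size p < size P)%N -> B p P = 0].

Lemma lmop_conj B n P : lmop (form_conj B) n P <-> rmop B n P.
Proof.
by split=> -[mP sP oP]; split => // p /oP; rewrite /form_conj => /eqP;
  rewrite ?conjC_eq0 => /eqP// ->; rewrite conjC0.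
Qed.

Lemma rmop_conj B n P : rmop (form_conj B) n P <-> lmop B n P.
Proof.
by split=> -[mP sP oP]; split => // p /oP; rewrite /form_conj => /eqP;
  rewrite ?conjC_eq0 => /eqP// ->; rewrite conjC0.
Qed.

Section Recurrence.
Variable (B : {poly F} -> {poly F} -> F).
Hypothesis tB : toeplitz_form B.

Lemma tf0 p : B 0 p = 0.
Proof. by rewrite -[0 in LHS](scale0r 0) (tfZ tB) mul0r. Qed.

Lemma tf0r p : B p 0 = 0.
Proof. by rewrite -[0 in LHS](scale0r 0) (tfZr tB) conjC0 mul0r. Qed.

Lemma tfB f g p : B (f - g) p = B f p - B g p.
Proof. by rewrite (tfD tB) -scaleN1r (tfZ tB) mulN1r. Qed.

Lemma tf_sum (I : Type) (r : seq I) (G : I -> {poly F}) p :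
  B (\sum_(i <- r) G i) p = \sum_(i <- r) B (G i) p.
Proof. by elim/big_rec2: _ => [|i x y _ <-]; rewrite ?tf0 ?(tfD tB). Qed.

Lemma tf_sumr (I : Type) (r : seq I) (G : I -> {poly F}) p :
  B p (\sum_(i <- r) G i) = \sum_(i <- r) B p (G i).
Proof. by elim/big_rec2: _ => [|i x y _ <-]; rewrite ?tf0r ?(tfDr tB). Qed.

Lemma size_monic_sub n P Q : P \is monic -> Q \is monic -> size P = n.+1 ->
  size Q = n.+1 -> (size (P - Q)%R <= n)%N.
Proof.
move=> /monicP mP /monicP mQ sP sQ.
apply/leq_sizeP => j; rewrite leq_eqVlt => /orP[/eqP<-|nj].
  by move: mP mQ; rewrite !lead_coefE sP sQ/= coefB => -> ->; rewrite subrr.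
by rewrite nth_default// (leq_trans (size_polyD _ _))// size_polyN sP sQ maxnn.
Qed.

Lemma size_monic_subX n P Q : P \is monic -> Q \is monic -> size P = n.+2 ->
  size Q = n.+1 -> (size (P - 'X * Q)%R <= n.+1)%N.
Proof.
move=> mP mQ sP sQ; apply: size_monic_sub => //; first by rewrite monicMl// monicX.
by rewrite mulrC size_mulX ?sQ// monic_neq0.
Qed.

(* The reversal of a polynomial of degree at most n orthogonal to z, ..., z^n *)
(* is right orthogonal to all lower degrees, hence a multiple of Q.           *)
Lemma szego_recurrence n P P1 Q : lmop B n P -> lmop B n.+1 P1 ->
  rmop B n Q -> (forall Q', rmop B n Q' -> Q = Q') ->
  exists c, P1 = 'X * P + c^* *: revp n Q.
Proof.
move=> [mP sP oP] [mP1 sP1 oP1] [mQ sQ oQ] uQ.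
pose D := P1 - 'X * P; pose g := revp n D.
have sD : (size D <= n.+1)%N by exact: size_monic_subX.
have oD p : (size p <= n)%N -> B D ('X * p) = 0.
  move=> sp; rewrite /D tfB (tfX tB) oP ?sP ?ltnS// oP1 ?subrr// sP1 ltnS.
  by rewrite (leq_trans (size_polyMleq _ _))// size_polyX.
have og p : (size p <= n)%N -> B p g = 0.
  case: (posnP n) => [n0|n0 sp]; first by rewrite n0 leqn0 size_poly_eq0 => /eqP->; rewrite tf0.
  rewrite -(@revpK F n p) ?(leqW sp)// (tf_revp tB) ?size_revp//.
  by rewrite -(prednK n0) revpS ?prednK// oD// -[leqRHS](prednK n0) size_revp.
have sg : (size g <= n.+1)%N by exact: size_revp.
have DE : D = revp n g by rewrite revpK.
clearbody g.
have Qn : Q`_n = 1 by move/monicP: mQ; rewrite lead_coefE sQ.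
pose h := g - g`_n *: Q.
have sh : (size h <= n)%N.
  apply/leq_sizeP => j; rewrite leq_eqVlt => /orP[/eqP<-|nj].
    by rewrite coefB coefZ Qn mulr1 subrr.
  rewrite coefB coefZ nth_default ?(leq_trans sg)// [Q`_j]nth_default ?sQ//.
  by rewrite mulr0 subrr.
have h0 : h = 0.
  suff QE : Q = Q + h by apply: (addrI Q); rewrite addr0.
  have sQh : size (Q + h)%R = n.+1 by rewrite size_polyDl sQ// ltnS.
  apply: uQ; split=> //.
    by apply/monicP; rewrite lead_coefE sQh coefD Qn [h`_n]nth_default// addr0.
  move=> p; rewrite sQh ltnS => sp; rewrite (tfDr tB) oQ ?sQ// add0r.
  rewrite /h (tfDr tB) og// add0r -scaleNr (tfZr tB) oQ ?sQ ?mulr0//.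
exists g`_n; apply/eqP; rewrite addrC -subr_eq -/D DE -revpZ; apply/eqP.
by congr revp; apply/eqP; rewrite -subr_eq0 -/h h0.
Qed.
End Recurrence.

Section SU2.
Variables (P Q : nat -> {poly F}) (a : nat -> F).
Hypothesis P0 : P 0 = 1.
Hypothesis Q0 : Q 0 = 1.
Hypothesis sP : forall n, (size (P n) <= n.+1)%N.
Hypothesis sQ : forall n, (size (Q n) <= n.+1)%N.
Hypothesis PS : forall n, P n.+1 = 'X * P n + (a n)^* *: revp n (Q n).
Hypothesis QS : forall n, Q n.+1 = 'X * Q n - (a n)^* *: revp n (P n).

Definition snorm n : F := \prod_(j < n) (1 + `|a j| ^+ 2).

Lemma snormS n : snorm n.+1 = snorm n * (1 + `|a n| ^+ 2).
Proof. by rewrite /snorm big_ord_recr. Qed.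

Lemma snorm_gt0 n : 0 < snorm n.
Proof. by apply: prodr_gt0 => j _; rewrite ltr_wpDr// exprn_ge0. Qed.

Lemma revpPS n : revp n.+1 (P n.+1) = revp n (P n) + a n *: ('X * Q n).
Proof. by rewrite PS revpD revpZ conjCK revpS_mulX revpS ?size_revp// revpK. Qed.

Lemma revpQS n : revp n.+1 (Q n.+1) = revp n (Q n) - a n *: ('X * P n).
Proof.
by rewrite QS revpD -scaleNr revpZ rmorphN/= conjCK revpS_mulX revpS ?size_revp// revpK// scaleNr.
Qed.

(* On the unit circle the recurrence is, up to normalization, a rotation. *)
Lemma norm_recQ n z : `|(Q n.+1).[z]| ^+ 2 + `|(revp n.+1 (P n.+1)).[z]| ^+ 2 =
  (1 + `|a n| ^+ 2) *
    (`|z| ^+ 2 * `|(Q n).[z]| ^+ 2 + `|(revp n (P n)).[z]| ^+ 2).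
Proof.
rewrite revpPS QS !(hornerD, hornerN, hornerZ, hornerM, hornerX).
set u := (Q n).[z]; set v := (revp n (P n)).[z].
rewrite !normCK !(rmorphD, rmorphB, rmorphN, rmorphM)/= conjCK.
by ring.
Qed.

Lemma norm_recP n z : `|(P n.+1).[z]| ^+ 2 + `|(revp n.+1 (Q n.+1)).[z]| ^+ 2 =
  (1 + `|a n| ^+ 2) *
    (`|z| ^+ 2 * `|(P n).[z]| ^+ 2 + `|(revp n (Q n)).[z]| ^+ 2).
Proof.
rewrite revpQS PS !(hornerD, hornerN, hornerZ, hornerM, hornerX).
set u := (P n).[z]; set v := (revp n (Q n)).[z].
rewrite !normCK !(rmorphD, rmorphB, rmorphN, rmorphM)/= conjCK.
by ring.
Qed.

Lemma revp0_1 : revp 0 1 = 1 :> {poly F}.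
Proof. by apply/polyP => -[|i]; rewrite coef_revp !coef1/= ?conjC1. Qed.

Lemma norm_growth (f g h M : nat -> F) (z m : F) :
  f 0 = 1 -> g 0 = 1 -> h 0 = 1 -> (forall n, h n.+1 = h n * M n) ->
  (forall n, `|f n.+1| ^+ 2 + `|g n.+1| ^+ 2 =
             M n * (`|z| ^+ 2 * `|f n| ^+ 2 + `|g n| ^+ 2)) ->
  (forall n, 0 <= M n) -> 1 <= m -> `|z| <= m ->
  forall n, `|f n| ^+ 2 + `|g n| ^+ 2 <= 2 * h n * m ^+ (2 * n).
Proof.
move=> f0 g0 h0 hS fgS M0 m1 zm; elim=> [|n ih].
  by rewrite f0 g0 h0 normr1 expr1n muln0 expr0 !mulr1.
rewrite fgS hS.
have -> : 2 * (h n * M n) * m ^+ (2 * n.+1) =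
    M n * (m ^+ 2 * (2 * h n * m ^+ (2 * n))) by rewrite mulnS exprD; ring.
rewrite ler_wpM2l//.
apply: le_trans (ler_wpM2l _ ih); last by rewrite exprn_ge0// (le_trans ler01).
rewrite mulrDr lerD// ?ler_wpM2r ?exprn_ge0//.
  by rewrite ler_pXn2r// nnegrE ?normr_ge0// (le_trans ler01).
by rewrite ler_peMl ?exprn_ge0// exprn_ege1.
Qed.

Lemma norm_leQ n z m : 1 <= m -> `|z| <= m ->
  `|(Q n).[z]| ^+ 2 + `|(revp n (P n)).[z]| ^+ 2 <= 2 * snorm n * m ^+ (2 * n).
Proof.
move=> m1 zm; apply: (@norm_growth (fun n => (Q n).[z]) (fun n => (revp n (P n)).[z])
  snorm (fun n => 1 + `|a n| ^+ 2) z m).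
- by rewrite Q0 hornerE.
- by rewrite P0 revp0_1 hornerE.
- by rewrite /snorm big_ord0.
- exact: snormS.
- by move=> k; exact: norm_recQ.
- by move=> k; rewrite addr_ge0// exprn_ge0.
- by [].
- by [].
Qed.

Lemma norm_leP n z m : 1 <= m -> `|z| <= m ->
  `|(P n).[z]| ^+ 2 + `|(revp n (Q n)).[z]| ^+ 2 <= 2 * snorm n * m ^+ (2 * n).
Proof.
move=> m1 zm; apply: (@norm_growth (fun n => (P n).[z]) (fun n => (revp n (Q n)).[z])
  snorm (fun n => 1 + `|a n| ^+ 2) z m).
- by rewrite P0 hornerE.
- by rewrite Q0 revp0_1 hornerE.
- by rewrite /snorm big_ord0.
- exact: snormS.
- by move=> k; exact: norm_recP.
- by move=> k; rewrite addr_ge0// exprn_ge0.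
- by [].
- by [].
Qed.

Definition cdker n (z y : F) : F :=
  \sum_(j < n.+1) (snorm j)^-1 * ((Q j).[z] * ((P j).[y])^*).

Lemma christoffel_darboux n z y :
  (1 - z * y^*) * cdker n z y = (snorm n.+1)^-1 *
    ((revp n.+1 (P n.+1)).[z] * ((revp n.+1 (Q n.+1)).[y])^*
     - (Q n.+1).[z] * ((P n.+1).[y])^*).
Proof.
pose U j := (revp j (P j)).[z] * ((revp j (Q j)).[y])^*.
pose V j := (Q j).[z] * ((P j).[y])^*.
have UV j : U j.+1 - V j.+1 = (1 + `|a j| ^+ 2) * (U j - z * y^* * V j).
  rewrite /U /V revpPS revpQS PS QS !(hornerD, hornerN, hornerZ, hornerM, hornerX) normCK.
  rewrite !(rmorphD, rmorphB, rmorphN, rmorphM)/= conjCK.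
  by ring.
have step j : (1 - z * y^*) * ((snorm j)^-1 * V j) =
    (snorm j.+1)^-1 * (U j.+1 - V j.+1) - (snorm j)^-1 * (U j - V j).
  rewrite UV snormS invfM [_ / _ * (_ * _)]mulrA mulfVK; last first.
    by rewrite gt_eqF// ltr_wpDr// exprn_ge0.
  by ring.
rewrite /cdker -/(U _) -/(V _); elim: n => [|n ih].
  rewrite big_ord1 -/(V 0) step.
  by rewrite /V /U P0 Q0 revp0_1 subrr mulr0 subr0.
by rewrite big_ord_recr mulrDr ih -/(V _) step/= addrC subrK.
Qed.

Definition kerp n (z : F) : {poly F} :=
  \sum_(j < n.+1) ((snorm j)^-1 * ((Q j).[z])^*) *: P j.

Lemma conj_snorm n : (snorm n)^* = snorm n.
Proof. by apply/CrealP; rewrite gtr0_real// snorm_gt0. Qed.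

Lemma horner_kerp n z y : (kerp n z).[y] = (cdker n z y)^*.
Proof.
rewrite /kerp /cdker horner_sum rmorph_sum; apply: eq_bigr => j _.
by rewrite hornerZ !rmorphM fmorphV/= conjCK conj_snorm mulrA.
Qed.

Lemma size_kerp n z : (size (kerp n z) <= n.+1)%N.
Proof.
apply: (leq_trans (size_sum _ _ _)); apply/bigmax_leqP => j _.
by rewrite (leq_trans (size_scale_leq _ _))// (leq_trans (sP _)).
Qed.

Lemma norm_mul_le (f g p q h m : F) j : 0 < h -> 1 <= m ->
  `|f| ^+ 2 + `|g| ^+ 2 <= 2 * h * m ^+ (2 * j) ->
  `|p| ^+ 2 + `|q| ^+ 2 <= 2 * h * 1 ^+ (2 * j) ->
  `|f * p^*| <= 2 * h * m ^+ j.
Proof.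
move=> h0 m1 fg pq; have m0 : 0 <= m by rewrite (le_trans ler01).
have h2 : 0 <= 2 * h * m ^+ j by rewrite !mulr_ge0 ?exprn_ge0// ltW.
rewrite -(@ler_pXn2r _ 2)// ?nnegrE//.
have -> : (2 * h * m ^+ j) ^+ 2 = (2 * h * m ^+ (2 * j)) * (2 * h * 1 ^+ (2 * j)).
  by rewrite expr1n mulnC exprM; ring.
rewrite normrM norm_conjC exprMn ler_pM ?exprn_ge0//.
  by apply: le_trans fg; rewrite lerDl exprn_ge0.
by apply: le_trans pq; rewrite lerDl exprn_ge0.
Qed.

Section Bounds.
Variables (n : nat) (z y m : F).
Hypotheses (m1 : 1 <= m) (zm : `|z| <= m) (y1 : `|y| = 1).

Let m0 : 0 <= m. Proof. by rewrite (le_trans ler01). Qed.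

Lemma cdker_le : `|cdker n z y| <= 2 * n.+1%:R * m ^+ n.
Proof.
rewrite (le_trans (ler_norm_sum _ _ _))//.
apply: (@le_trans _ _ (\sum_(j < n.+1) (2 * m ^+ n))); last first.
  by rewrite sumr_const card_ord -[_ *+ n.+1]mulr_natr mulrAC.
apply: ler_sum => j _; rewrite normrM gtr0_norm ?invr_gt0 ?snorm_gt0//.
rewrite ler_pdivrMl ?snorm_gt0//.
apply: (@le_trans _ _ (2 * snorm j * m ^+ j)).
  apply: (norm_mul_le (snorm_gt0 j) m1 (norm_leQ j m1 zm)).
  by apply: norm_leP; rewrite ?y1.
rewrite mulrA [snorm j * _]mulrC ler_wpM2l ?mulr_ge0 ?(ltW (snorm_gt0 _))//.
by rewrite ler_weXn2l// -ltnS.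
Qed.

Lemma cdker_dist_le : `|y - z| * `|cdker n z y| <= 4 * m ^+ n.+1.
Proof.
have -> : `|y - z| = `|1 - z * y^*|.
  have yy : y * y^* = 1 by rewrite -normCK y1 expr1n.
  have -> : y - z = y * (1 - z * y^*) by rewrite mulrBr mulrCA yy !mulr1.
  by rewrite normrM y1 mul1r.
rewrite -normrM christoffel_darboux normrM.
rewrite gtr0_norm ?invr_gt0 ?snorm_gt0// ler_pdivrMl ?snorm_gt0//.
rewrite (le_trans (ler_normB _ _))//.
have -> : snorm n.+1 * (4 * m ^+ n.+1) =
  2 * snorm n.+1 * m ^+ n.+1 + 2 * snorm n.+1 * m ^+ n.+1 by ring.
have hQ := norm_leQ n.+1 m1 zm.
have hP : `|(P n.+1).[y]| ^+ 2 + `|(revp n.+1 (Q n.+1)).[y]| ^+ 2 <=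
  2 * snorm n.+1 * 1 ^+ (2 * n.+1) by apply: norm_leP; rewrite ?y1.
rewrite lerD//; last exact: norm_mul_le (snorm_gt0 _) m1 hQ hP.
by rewrite addrC in hQ; rewrite addrC in hP; exact: norm_mul_le (snorm_gt0 _) m1 hQ hP.
Qed.
End Bounds.

Section Reproducing.
Variable B : {poly F} -> {poly F} -> F.
Hypothesis tB : toeplitz_form B.
Hypothesis B11 : B 1 1 = 1.
Hypothesis Pmop : forall n, lmop B n (P n).
Hypothesis Qmop : forall n, rmop B n (Q n).

Lemma form_P_eq0 n p : (size p <= n)%N -> B (P n) p = 0.
Proof. by have [_ sPn oPn] := Pmop n => sp; rewrite oPn// sPn. Qed.

Lemma form_Q_eq0 n p : (size p <= n)%N -> B p (Q n) = 0.
Proof. by have [_ sQn oQn] := Qmop n => sp; rewrite oQn// sQn. Qed.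

Lemma form_PQ n : B (P n) (Q n) = snorm n.
Proof.
elim: n => [|n ih]; first by rewrite P0 Q0 B11 /snorm big_ord0.
have [mQ sQn _] := Qmop n; have [mQ1 sQn1 _] := Qmop n.+1.
have -> : B (P n.+1) (Q n.+1) = B (P n.+1) ('X * Q n).
  rewrite -[Q n.+1](subrK ('X * Q n)) (tfDr tB) form_P_eq0 ?add0r//.
  exact: size_monic_subX.
have rE : revp n (Q n) = revp n.+1 (Q n.+1) + a n *: ('X * P n).
  by rewrite revpQS subrK.
rewrite PS (tfD tB) (tfX tB) ih (tfZ tB) rE (tfD tB) (tfZ tB) (tfX tB) ih.
rewrite -(revpS_mulX) in rE *.
have -> : B (revp n.+1 (Q n.+1)) ('X * Q n) = 0.
  rewrite -[_ * _](@revpK F n.+1) ?(tf_revp tB) ?size_revp//; last first.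
    by rewrite (leq_trans (size_polyMleq _ _))// size_polyX/= ltnS sQ.
  by rewrite revpS_mulX form_Q_eq0// size_revp.
by rewrite snormS normCK; ring.
Qed.

Lemma reproducing N f z : (size f <= N)%N ->
  \sum_(j < N) (snorm j)^-1 * ((Q j).[z])^* * B (P j) f = (f.[z])^*.
Proof.
elim: N f => [|N ih] f sf.
  move: sf; rewrite leqn0 size_poly_eq0 => /eqP->.
  by rewrite big_ord0 horner0 conjC0.
have [/monicP mQ sQN _] := Qmop N; rewrite lead_coefE sQN/= in mQ.
pose g := f - f`_N *: Q N.
have sg : (size g <= N)%N.
  apply/leq_sizeP => j; rewrite leq_eqVlt => /orP[/eqP<-|nj].
    by rewrite coefB coefZ mQ mulr1 subrr.
  rewrite coefB coefZ nth_default ?(leq_trans sf)// [(Q N)`_j]nth_default ?sQN//.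
  by rewrite mulr0 subrr.
have fE : f = g + f`_N *: Q N by rewrite subrK.
have BPf j : B (P j) f = B (P j) g + (f`_N)^* * B (P j) (Q N).
  by rewrite {1}fE (tfDr tB) (tfZr tB).
rewrite big_ord_recr/= BPf form_P_eq0// add0r form_PQ.
under eq_bigr => j _ do rewrite BPf form_Q_eq0 ?(leq_trans (sP _))// mulr0 addr0.
rewrite ih// [in RHS]fE hornerD hornerZ rmorphD rmorphM.
by field; rewrite gt_eqF ?snorm_gt0.
Qed.

Lemma form_kerp n f z : (size f <= n.+1)%N -> B (kerp n z) f = (f.[z])^*.
Proof.
move=> sf; rewrite -(reproducing z sf) /kerp (tf_sum tB).
by apply: eq_bigr => j _; rewrite (tfZ tB).
Qed.
End Reproducing.
End SU2.

End ToeplitzForm.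

(** * Integration against a complex measure *)

Local Open Scope complex_scope.

Section BoundedMeasurable.
Context d (T : measurableType d) (R : realType).
Implicit Types (f g : T -> R) (L : (T -> R) -> R).

Definition bmf f := measurable_fun setT f /\ exists M, forall x, `|f x| <= M.

Lemma bmf_cst (c : R) : bmf (fun=> c).
Proof. by split; [exact: measurable_cst|exists `|c|]. Qed.

Lemma bmfD f g : bmf f -> bmf g -> bmf (fun x => f x + g x).
Proof.
move=> [mf [M fM]] [mg [N gN]]; split; first exact: measurable_funD.
by exists (M + N) => x; rewrite (le_trans (ler_normD _ _))// lerD.
Qed.

Lemma bmfM f g : bmf f -> bmf g -> bmf (fun x => f x * g x).
Proof.
move=> [mf [M fM]] [mg [N gN]]; split; first exact: measurable_funM.
by exists (M * N) => x; rewrite normrM ler_pM.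
Qed.

Lemma bmfZ c f : bmf f -> bmf (fun x => c * f x).
Proof. exact/bmfM/bmf_cst. Qed.

Lemma bmfN f : bmf f -> bmf (fun x => - f x).
Proof.
move=> /(bmfZ (-1)) bf; congr bmf: bf; apply/funext => x.
by rewrite mulN1r.
Qed.

Lemma bmfB f g : bmf f -> bmf g -> bmf (fun x => f x - g x).
Proof. by move=> bf /bmfN; exact: bmfD. Qed.

Lemma bmf_indic (A : set T) : measurable A -> bmf (\1_A).
Proof.
move=> mA; split; first exact: measurable_indic.
by exists 1 => x; rewrite indicE; case: (x \in A); rewrite ?normr1 ?normr0.
Qed.

Lemma bmf_integrable (m : {finite_measure set T -> \bar R}) f :
  bmf f -> m.-integrable setT (EFin \o f).
Proof.
move=> [mf [M fM]]; apply: measurable_bounded_integrable => //.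
  by rewrite ltey_eq fin_num_measure.
exists M; split; first exact: num_real.
by move=> N MN x _; rewrite /= (le_trans (fM _))// ltW.
Qed.

Record bounded_functional L : Prop := BoundedFunctional {
  bfunD : forall f g, bmf f -> bmf g -> L (fun x => f x + g x) = L f + L g ;
  bfunZ : forall c f, bmf f -> L (fun x => c * f x) = c * L f ;
  bfunV : exists2 V, 0 <= V & forall f e, bmf f -> (forall x, `|f x| <= e) ->
    `|L f| <= V * e }.

Lemma bounded_functional_Rintegral (m : {finite_measure set T -> \bar R}) :
  bounded_functional (Rintegral m setT).
Proof.
split=> [f g bf bg|c f bf|].
- by rewrite RintegralD//; exact: bmf_integrable.
- by rewrite RintegralZl//; exact: bmf_integrable.
- exists (fine (m setT)); first by rewrite fine_ge0.
  move=> f e bf fe; rewrite (le_trans (le_normr_Rintegral _ _))//.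
    exact: bmf_integrable.
  rewrite mulrC -(Rintegral_cst m measurableT); apply: le_Rintegral => //.
    case: (bf) => mf [M fM]; apply: (@bmf_integrable m (fun x => `|f x|)).
    split; first exact: measurableT_comp.
    by exists M => x; rewrite normr_id.
  exact/bmf_integrable/bmf_cst.
Qed.

Lemma bounded_functional_comb L1 L2 c :
  bounded_functional L1 -> bounded_functional L2 ->
  bounded_functional (fun f => L1 f + c * L2 f).
Proof.
move=> bL1 bL2; split=> [f g bf bg|k f bf|].
- by rewrite (bfunD bL1)// (bfunD bL2)//; ring.
- by rewrite (bfunZ bL1)// (bfunZ bL2)//; ring.
have [V V0 LV] := bfunV bL1; have [W W0 LW] := bfunV bL2.
exists (V + `|c| * W); first by rewrite addr_ge0// mulr_ge0.
move=> f e bf fe; rewrite (le_trans (ler_normD _ _))// mulrDl lerD//; first exact: LV.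
by rewrite normrM -mulrA ler_wpM2l// LW.
Qed.

(* kap x is the index of the cell of mesh e that contains f x. *)
Lemma step_approx f (e : R) : bmf f -> 0 < e ->
  exists N (kap : T -> 'I_N) (c : 'I_N -> R),
    (forall k, measurable (kap @^-1` [set k])) /\
    (forall x, `|f x - c (kap x)| <= e).
Proof.
move=> [mf [M fM]] e0.
pose N := (Num.truncn (2 * M / e)).+1.
have fN x : 0 <= (f x + M) / e.
  apply: divr_ge0; last exact: ltW.
  by rewrite -lerBlDr sub0r; have := fM x; rewrite ler_norml => /andP[].
pose kap x : 'I_N.+1 := inord (Num.truncn ((f x + M) / e)).
have kapE x : kap x = Num.truncn ((f x + M) / e) :> nat.
  rewrite inordK// ltnS ltnW// ltnS; apply: le_truncn.
  rewrite ler_pM2r ?invr_gt0//.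
  by rewrite mulr2n mulrDl mul1r lerD2r; have := fM x; rewrite ler_norml => /andP[].
have kapP x k : (kap x == k) = (k%:R * e - M <= f x < k.+1%:R * e - M).
  rewrite -val_eqE/= kapE truncn_eq// ler_pdivlMr// ltr_pdivrMr//.
  by rewrite lerBlDr ltrBrDr.
exists N.+1, kap, (fun k => k%:R * e - M); split.
  move=> k; have -> : kap @^-1` [set k] = f @^-1` `[k%:R * e - M, k.+1%:R * e - M[.
    apply/seteqP; split=> x /=; rewrite in_itv/= -kapP.
      by move=> ->.
    by move=> /eqP.
  by rewrite -[X in measurable X]setTI; exact: mf.
move=> x; have : kap x == kap x by [].
rewrite kapP => /andP[h1 h2]; rewrite ger0_norm ?subr_ge0//.
move: h2; rewrite -natr1 mulrDl mul1r; lra.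
Qed.

Lemma bounded_functional_sum L (I : Type) (r : seq I) (G : I -> T -> R) :
  bounded_functional L -> (forall i, bmf (G i)) ->
  bmf (fun x => \sum_(i <- r) G i x) /\
  L (fun x => \sum_(i <- r) G i x) = \sum_(i <- r) L (G i).
Proof.
move=> bL bG; elim: r => [|i r [bS LS]].
  under eq_fun do rewrite big_nil.
  split; first exact: bmf_cst.
  by have := bfunZ bL 0 (bmf_cst 0); rewrite !mul0r big_nil.
under eq_fun do rewrite big_cons.
split; first exact: bmfD.
by rewrite (bfunD bL)// LS big_cons.
Qed.

Lemma sum_fiber (I : finType) (V : pzRingType) (kap : T -> I) (c : I -> V) x :
  c (kap x) = \sum_k c k * \1_(kap @^-1` [set k]) x.
Proof.
rewrite (bigD1 (kap x))//= indicE mem_set// mulr1 big1 ?addr0// => k kx.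
by rewrite indicE memNset ?mulr0// => /= /esym; exact/eqP.
Qed.

Lemma bounded_functional_step L (I : finType) (kap : T -> I) (c : I -> R) :
  bounded_functional L -> (forall k, measurable (kap @^-1` [set k])) ->
  bmf (fun x => c (kap x)) /\
  L (fun x => c (kap x)) = \sum_k c k * L (\1_(kap @^-1` [set k])).
Proof.
move=> bL mk; under eq_fun do rewrite sum_fiber.
have bi k : bmf (\1_(kap @^-1` [set k]) : T -> R) by exact: bmf_indic.
have [bS LS] := bounded_functional_sum (index_enum I) bL (fun k => bmfZ (c k) (bi k)).
by split=> //; rewrite LS; apply: eq_bigr => k _; rewrite (bfunZ bL).
Qed.

Lemma bounded_functional_eq L1 L2 :
  bounded_functional L1 -> bounded_functional L2 ->
  (forall A, measurable A -> L1 \1_A = L2 \1_A) ->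
  forall f, bmf f -> L1 f = L2 f.
Proof.
move=> bL1 bL2 L12 f bf.
have bL := bounded_functional_comb (-1) bL1 bL2.
have [V V0 LV] := bfunV bL.
suff H e : 0 < e -> `|L1 f + (-1) * L2 f| <= V * e.
  apply/eqP; rewrite -subr_eq0 -mulN1r -normr_le0; apply/ler_addgt0Pr => e e0.
  rewrite add0r (le_trans (H (e / (V + 1)) _))//.
    by rewrite divr_gt0// ltr_wpDl.
  by rewrite mulrCA ler_piMr ?(ltW e0)// ler_pdivrMr ?ltr_wpDl// mul1r lerDl.
move=> e0; have [N [kap [c [mk ke]]]] := step_approx bf e0.
have [bs Ls] := bounded_functional_step c bL mk.
have -> : L1 f + -1 * L2 f = (L1 (fun x => f x - c (kap x)) + -1 * L2 (fun x => f x - c (kap x))).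
  have {1 2}-> : f = (fun x => (f x - c (kap x)) + c (kap x)).
    by apply/funext => x; rewrite subrK.
  rewrite (bfunD bL); [|exact: bmfB|by []].
  rewrite Ls big1 ?addr0// => k _; rewrite L12// mulN1r subrr mulr0//.
by apply: (LV (fun x => f x - c (kap x))) => //; exact: bmfB.
Qed.

Section ChargeIntegral.
Implicit Type nu : {charge set T -> \bar R}.

Lemma bounded_functional_charge nu : bounded_functional (charge_integral nu).
Proof.
have := bounded_functional_comb (-1)
  (bounded_functional_Rintegral (jordan_pos (svalP (hahn nu))))
  (bounded_functional_Rintegral (jordan_neg (svalP (hahn nu)))).
congr bounded_functional; apply/funext => f.
by rewrite mulN1r.
Qed.

Lemma Rintegral_indic (m : {measure set T -> \bar R}) A : measurable A ->
  \int[m]_x (\1_A x) = fine (m A) :> R.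
Proof. by move=> mA; rewrite /Rintegral integral_indic// setIT. Qed.

Lemma charge_integral_indic nu A : measurable A ->
  charge_integral nu \1_A = fine (nu A).
Proof.
move=> mA; rewrite /charge_integral !Rintegral_indic//.
rewrite (jordan_decomp (svalP (hahn nu)) mA) /cadd/= cscaleN1 fineB//; exact: fin_num_measure.
Qed.

Lemma charge_integral_comb nu nu1 nu2 c f :
  (forall A, measurable A -> fine (nu A) = fine (nu1 A) + c * fine (nu2 A)) ->
  bmf f -> charge_integral nu f = charge_integral nu1 f + c * charge_integral nu2 f.
Proof.
move=> nuE; apply: (bounded_functional_eq (L1 := charge_integral nu)
  (L2 := fun f => charge_integral nu1 f + c * charge_integral nu2 f)).
- exact: bounded_functional_charge.
- by apply: bounded_functional_comb; exact: bounded_functional_charge.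
- by move=> A mA; rewrite !charge_integral_indic// nuE.
Qed.

Lemma charge_integral_measure (m : {finite_measure set T -> \bar R}) f :
  bmf f -> charge_integral (charge_of_finite_measure m) f = \int[m]_x f x.
Proof.
apply: (bounded_functional_eq (L2 := Rintegral m setT)).
- exact: bounded_functional_charge.
- exact: bounded_functional_Rintegral.
- by move=> A mA; rewrite charge_integral_indic// Rintegral_indic.
Qed.
End ChargeIntegral.
End BoundedMeasurable.

Lemma complex_eq (R : rcfType) (x y : R[i]) :
  complex.Re x = complex.Re y -> complex.Im x = complex.Im y -> x = y.
Proof. by case: x y => [a b] [a' b'] /= -> ->. Qed.

Section ComplexIntegral.
Context d (T : measurableType d) (R : realType).
Implicit Types (f g : T -> R[i]) (nu : complex_measure T R).

Definition bmc g := bmf (fun x => complex.Re (g x)) /\ bmf (fun x => complex.Im (g x)).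

Lemma bmc_cst c : bmc (fun=> c).
Proof. by split; exact: bmf_cst. Qed.

Lemma bmcD f g : bmc f -> bmc g -> bmc (fun x => f x + g x).
Proof.
move=> [f1 f2] [g1 g2]; split; under eq_fun do rewrite raddfD/=; exact: bmfD.
Qed.

Lemma ReM (x y : R[i]) : complex.Re (x * y) =
  complex.Re x * complex.Re y - complex.Im x * complex.Im y.
Proof. by case: x y => [a b] [a' b']. Qed.

Lemma ImM (x y : R[i]) : complex.Im (x * y) =
  complex.Re x * complex.Im y + complex.Im x * complex.Re y.
Proof. by case: x y => [a b] [a' b']. Qed.

Lemma bmcM f g : bmc f -> bmc g -> bmc (fun x => f x * g x).
Proof.
move=> [f1 f2] [g1 g2]; split.
  by under eq_fun do rewrite ReM; apply: bmfB; exact: bmfM.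
by under eq_fun do rewrite ImM; apply: bmfD; exact: bmfM.
Qed.

Lemma bmcN f : bmc f -> bmc (fun x => - f x).
Proof.
by move=> [f1 f2]; split; under eq_fun do rewrite raddfN/=; exact: bmfN.
Qed.

Lemma bmc_conj f : bmc f -> bmc (fun x => (f x)^*%C).
Proof.
move=> [f1 f2]; split.
  congr bmf: f1; apply/funext => x; by case: (f x).
congr bmf: (bmfN f2); apply/funext => x; by case: (f x).
Qed.

Lemma bmcX f n : bmc f -> bmc (fun x => f x ^+ n).
Proof.
move=> bf; elim: n => [|n ih]; first exact: bmc_cst.
by under eq_fun do rewrite exprS; exact: bmcM.
Qed.

Lemma bmc_sum (I : Type) (r : seq I) (G : I -> T -> R[i]) :
  (forall i, bmc (G i)) -> bmc (fun x => \sum_(i <- r) G i x).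
Proof.
move=> bG; elim: r => [|i r ih].
  by under eq_fun do rewrite big_nil; exact: bmc_cst.
by under eq_fun do rewrite big_cons; exact: bmcD.
Qed.

Lemma bmc_horner (p : {poly R[i]}) f : bmc f -> bmc (fun x => p.[f x]).
Proof.
move=> bf; under eq_fun do rewrite horner_coef.
by apply: bmc_sum => i; apply: bmcM; [exact: bmc_cst|exact: bmcX].
Qed.

Lemma cm_integralD nu f g : bmc f -> bmc g ->
  cm_integral nu (fun x => f x + g x) = cm_integral nu f + cm_integral nu g.
Proof.
move=> [f1 f2] [g1 g2].
have HR (k : {charge set T -> \bar R}) :
    charge_integral k (fun x => complex.Re (f x + g x)) =
    charge_integral k (fun x => complex.Re (f x)) + charge_integral k (fun x => complex.Re (g x)).
  rewrite -(bfunD (bounded_functional_charge _))//.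
  by congr charge_integral; apply/funext => x; rewrite raddfD.
have HI (k : {charge set T -> \bar R}) :
    charge_integral k (fun x => complex.Im (f x + g x)) =
    charge_integral k (fun x => complex.Im (f x)) + charge_integral k (fun x => complex.Im (g x)).
  rewrite -(bfunD (bounded_functional_charge _))//.
  by congr charge_integral; apply/funext => x; rewrite raddfD.
by apply: complex_eq; rewrite /cm_integral/= !HR !HI; ring.
Qed.

Lemma cm_integralZ nu c g : bmc g ->
  cm_integral nu (fun x => c * g x) = c * cm_integral nu g.
Proof.
move=> [g1 g2].
have HR (k : {charge set T -> \bar R}) : charge_integral k (fun y => complex.Re (c * g y)) =
    complex.Re c * charge_integral k (fun y => complex.Re (g y)) +
    (- complex.Im c) * charge_integral k (fun y => complex.Im (g y)).
  rewrite -!(bfunZ (bounded_functional_charge _))// -(bfunD (bounded_functional_charge _));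
    [|exact: bmfZ..].
  by congr charge_integral; apply/funext => x; rewrite ReM mulNr.
have HI (k : {charge set T -> \bar R}) : charge_integral k (fun y => complex.Im (c * g y)) =
    complex.Re c * charge_integral k (fun y => complex.Im (g y)) +
    complex.Im c * charge_integral k (fun y => complex.Re (g y)).
  rewrite -!(bfunZ (bounded_functional_charge _))// -(bfunD (bounded_functional_charge _));
    [|exact: bmfZ..].
  by congr charge_integral; apply/funext => x; rewrite ImM.
by apply: complex_eq; rewrite ?ReM ?ImM /cm_integral/= !HR !HI; ring.
Qed.

Lemma cm_integral_sum nu (I : Type) (r : seq I) (G : I -> T -> R[i]) :
  (forall i, bmc (G i)) ->
  cm_integral nu (fun x => \sum_(i <- r) G i x) = \sum_(i <- r) cm_integral nu (G i).
Proof.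
move=> bG; elim: r => [|i r ih].
  under eq_fun do rewrite big_nil.
  by have := cm_integralZ nu 0 (bmc_cst 0); rewrite !mul0r big_nil.
under eq_fun do rewrite big_cons.
by rewrite cm_integralD// ?ih ?big_cons//; exact: bmc_sum.
Qed.

Lemma cm_integral_sub_scale nu c (m : {finite_measure set T -> \bar R}) g : bmc g ->
  cm_integral (cm_sub nu (cm_scale c (charge_of_finite_measure m))) g =
  cm_integral nu g -
  c * ((\int[m]_x complex.Re (g x)) +i* (\int[m]_x complex.Im (g x))).
Proof.
move=> [g1 g2]; set mc := charge_of_finite_measure m.
have H (k : {charge set T -> \bar R}) a h : bmf h ->
    charge_integral (cadd k (copp (cscale a mc))) h =
    charge_integral k h - a * \int[m]_x h x.
  move=> bh; rewrite -mulNr -charge_integral_measure//.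
  apply: charge_integral_comb => // A mA.
  rewrite /cadd/= /copp/= /cscale/= fineD ?fineN ?fineM ?mulNr//.
  - exact: fin_num_measure.
  - exact: fin_num_measure.
  - by rewrite fin_numN fin_numM// fin_num_measure.
by apply: complex_eq; rewrite ?raddfB/= ?ReM ?ImM /= !H//; ring.
Qed.

Lemma cm_integral_indic nu (A : set T) : measurable A ->
  cm_integral nu (fun x => \1_A x) = nu A.
Proof.
move=> mA.
have HR : (fun y => complex.Re (\1_A y : R[i])) = \1_A :> (T -> R).
  by apply/funext => y; rewrite !indicE; case: (y \in A).
have HI : (fun y => complex.Im (\1_A y : R[i])) = (fun=> 0 * 0) :> (T -> R).
  by apply/funext => y; rewrite !indicE mul0r; case: (y \in A).
rewrite /cm_integral HR HI !(bfunZ (bounded_functional_charge _)) ?mul0r ?subr0 ?add0r;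
  try exact: bmf_cst.
by rewrite !charge_integral_indic.
Qed.

Section Variation.
Variable nu : complex_measure T R.
Local Open Scope ereal_scope.

Lemma cm_variation_ge_normc A : measurable A ->
  (normc (nu A))%:E <= cm_variation nu A.
Proof.
move=> mA; apply: ereal_sup_ubound; exists 1%N, (fun k => if k is 0%N then A else set0).
split.
- by case.
- by case=> [|i] [|j] _ _ // [t [//]].
- by case=> [//|k t []].
- by rewrite big_ord_recl big_ord0 adde0.
Qed.

Lemma cm_variation_fin : cm_variation nu setT < +oo.
Proof.
pose v1 := charge_variation (svalP (hahn (cm_Re nu))).
pose v2 := charge_variation (svalP (hahn (cm_Im nu))).
apply: (@le_lt_trans _ _ (v1 setT + v2 setT)); last first.
  by rewrite ltey_eq fin_numD !fin_num_measure.
apply/ge_ereal_sup => _ [n [F [mF tF _ ->]]].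
apply: (@le_trans _ _ (\sum_(k < n) (v1 (F k) + v2 (F k)))).
  apply: lee_sum => k _.
  apply: (@le_trans _ _ (`|cm_Re nu (F k)| + `|cm_Im nu (F k)|)).
    rewrite -[X in `|X| + _]fineK ?fin_num_measure// -[X in _ + `|X|]fineK ?fin_num_measure//.
    by rewrite !abse_EFin -EFinD lee_fin normc_le_ReIm.
  by apply: leeD; exact: abse_charge_variation.
rewrite big_split/=; apply: leeD.
- by rewrite -measure_bigsetU//; apply: le_measure; rewrite ?inE//; exact: bigsetU_measurable.
- by rewrite -measure_bigsetU//; apply: le_measure; rewrite ?inE//; exact: bigsetU_measurable.
Qed.
End Variation.
End ComplexIntegral.

Section VariationInequality.
Context d (T : measurableType d) (R : realType).
Variable nu : complex_measure T R.

Lemma normc_ge0 (z : R[i]) : 0 <= normc z.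
Proof. by case: z => a b; exact: sqrtr_ge0. Qed.

Lemma measurable_normc (g : T -> R[i]) : bmc g ->
  measurable_fun setT (fun x => normc (g x)).
Proof.
move=> [[m1 _] [m2 _]].
have -> : (fun x => normc (g x)) =
    Num.sqrt \o (fun x => complex.Re (g x) ^+ 2 + complex.Im (g x) ^+ 2).
  by apply/funext => x /=; case: (g x).
have ms : measurable_fun setT (@Num.sqrt R).
  by apply: continuous_measurable_fun; exact: sqrt_continuous.
apply: measurableT_comp => //.
by apply: measurable_funD; exact: measurable_funX.
Qed.

Lemma normc_cm_integral_small g (V1 V2 e : R) : bmc g ->
  (forall f e, bmf f -> (forall x : T, `|f x| <= e) ->
     `|charge_integral (cm_Re nu) f| <= V1 * e) ->
  (forall f e, bmf f -> (forall x : T, `|f x| <= e) ->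
     `|charge_integral (cm_Im nu) f| <= V2 * e) ->
  (forall x, `|complex.Re (g x)| <= e) -> (forall x, `|complex.Im (g x)| <= e) ->
  normc (cm_integral nu g) <= 2 * (V1 + V2) * e.
Proof.
move=> [g1 g2] H1 H2 gR gI; rewrite (le_trans (normc_le_ReIm _))//=.
have -> : 2 * (V1 + V2) * e = (V1 * e + V2 * e) + (V1 * e + V2 * e) by ring.
apply: lerD.
  by rewrite (le_trans (ler_normB _ _))// lerD// ?H1 ?H2.
by rewrite (le_trans (ler_normD _ _))// lerD// ?H1 ?H2.
Qed.

Lemma cm_integral_step (I : finType) (kap : T -> I) (c : I -> R[i]) :
  (forall k, measurable (kap @^-1` [set k])) ->
  bmc (fun x => c (kap x)) /\
  cm_integral nu (fun x => c (kap x)) = \sum_k c k * nu (kap @^-1` [set k]).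
Proof.
move=> mk; under eq_fun do rewrite sum_fiber.
have bi k : bmc (fun x => \1_(kap @^-1` [set k]) x : R[i]).
  split.
    have := bmf_indic R (mk k); congr bmf; apply/funext => x.
    by rewrite !indicE; case: (_ \in _).
  have := bmf_cst T (0 : R); congr bmf; apply/funext => x.
  by rewrite !indicE; case: (_ \in _).
have bci k := bmcM (bmc_cst T (c k)) (bi k).
split; first exact: bmc_sum.
rewrite cm_integral_sum//; apply: eq_bigr => k _.
by rewrite cm_integralZ// cm_integral_indic.
Qed.

Lemma integral_variation_step (I : finType) (kap : T -> I) (c : I -> R) :
  (forall k, measurable (kap @^-1` [set k])) -> (forall k, 0 <= c k) ->
  (\int[cm_variation nu]_x (c (kap x))%:E =
   \sum_k (c k)%:E * cm_variation nu (kap @^-1` [set k]))%E.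
Proof.
move=> mk c0; under eq_integral do rewrite sum_fiber -sumEFin.
rewrite ge0_integral_sum//.
- apply: eq_bigr => k _; under eq_integral do rewrite EFinM.
  rewrite ge0_integralZl_EFin//.
  + by rewrite integral_indic// setIT.
  + exact/measurable_EFinP/measurable_indic.
- move=> k; apply/measurable_EFinP.
  by apply: measurable_funM => //; exact: measurable_indic.
- by move=> k x _; rewrite lee_fin mulr_ge0.
Qed.

Theorem normc_cm_integral_le g : bmc g ->
  ((normc (cm_integral nu g))%:E <=
   \int[cm_variation nu]_x (normc (g x))%:E)%E.
Proof.
move=> bg; have [g1 g2] := bg.
have [V1 V10 H1] := bfunV (bounded_functional_charge (cm_Re nu)).
have [V2 V20 H2] := bfunV (bounded_functional_charge (cm_Im nu)).
have Wfin : cm_variation nu setT \is a fin_num.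
  by rewrite ge0_fin_numE ?cm_variation_fin.
pose W := fine (cm_variation nu setT).
have W0 : 0 <= W by exact: fine_ge0.
apply/lee_addgt0Pr => e e0.
pose D := 2 * (V1 + V2 + W) + 1.
have D0 : 0 < D by rewrite ltr_wpDl// mulr_ge0// !addr_ge0.
pose t := e / D.
have t0 : 0 < t by rewrite divr_gt0.
have [N1 [k1 [c1 [mk1 kc1]]]] := step_approx g1 t0.
have [N2 [k2 [c2 [mk2 kc2]]]] := step_approx g2 t0.
pose kap x := (k1 x, k2 x); pose c (k : 'I_N1 * 'I_N2) := c1 k.1 +i* c2 k.2.
have mk k : measurable (kap @^-1` [set k]).
  have -> : kap @^-1` [set k] = k1 @^-1` [set k.1] `&` k2 @^-1` [set k.2].
    by apply/seteqP; split => x /=; case: k => a b /= []; rewrite /kap => -> ->.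
  exact: measurableI.
have [bs Is] := cm_integral_step c mk.
have bgs : bmc (fun x => g x - c (kap x)) by apply: bmcD => //; exact: bmcN.
have sg x : normc (c (kap x)) <= normc (g x) + 2 * t.
  have -> : c (kap x) = g x + - (g x - c (kap x)) by rewrite opprB addrC subrK.
  rewrite (le_trans (le_normcD _ _))// lerD2l normcN (le_trans (normc_le_ReIm _))//.
  by rewrite !raddfB/= mulr2n mulrDl mul1r lerD.
have -> : cm_integral nu g = cm_integral nu (fun x => g x - c (kap x)) +
    \sum_k c k * nu (kap @^-1` [set k]).
  rewrite -Is -cm_integralD//; congr cm_integral; apply/funext => x.
  by rewrite subrK.
apply: (@le_trans _ _ ((2 * (V1 + V2) * t)%:E + \int[cm_variation nu]_x (normc (c (kap x)))%:E)%E).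
  rewrite (@integral_variation_step _ kap (fun k => normc (c k)))//; last first.
    by move=> k; exact: normc_ge0.
  apply: (@le_trans _ _ ((normc (cm_integral nu (fun x => g x - c (kap x))))%:E +
      (normc (\sum_k c k * nu (kap @^-1` [set k])))%:E)%E).
    by rewrite -EFinD lee_fin le_normcD.
  apply: leeD.
    rewrite lee_fin; apply: normc_cm_integral_small => // x; rewrite raddfB/=.
      exact: kc1.
    exact: kc2.
  apply: (@le_trans _ _ (\sum_k (normc (c k) * normc (nu (kap @^-1` [set k])))%:E)%E).
    rewrite sumEFin lee_fin; elim/big_ind2: _ => [|a a' b b' aa bb|k _].
    - by rewrite normc0.
    - by rewrite (le_trans (le_normcD _ _))// lerD.
    - by rewrite normcM.
  apply: lee_sum => k _; rewrite EFinM; apply: lee_pmul => //.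
  - by rewrite lee_fin normc_ge0.
  - by rewrite lee_fin normc_ge0.
  - exact: cm_variation_ge_normc.
have mg := measurable_normc bg.
have -> : e = 2 * (V1 + V2) * t + (2 * t * W + t).
  have -> : 2 * (V1 + V2) * t + (2 * t * W + t) = t * D by rewrite /D; ring.
  by rewrite /t divfK// gt_eqF.
rewrite EFinD [leRHS]addeCA; apply: leeD => //.
apply: (@le_trans _ _ (\int[cm_variation nu]_x ((normc (g x))%:E + (2 * t)%:E))%E).
  apply: ge0_le_integral => //.
  - by move=> x _; rewrite lee_fin normc_ge0.
  - exact/measurable_EFinP/measurable_normc.
  - exact/measurable_EFinP/measurable_funD.
  - by move=> x _; rewrite -EFinD lee_fin.
have mgE := proj2 (measurable_EFinP _ _) mg.
rewrite ge0_integralD//; [|by move=> x _; rewrite lee_fin normc_ge0|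
  by move=> x _; rewrite lee_fin mulr_ge0// ltW].
have -> : (\int[cm_variation nu]_x (2 * t)%:E = (2 * t * W)%:E)%E.
  by rewrite integral_cst// [RHS]EFinM fineK.
by rewrite leeD// lee_fin lerDl ltW.
Qed.
End VariationInequality.

(** * The unit circle *)

Section CircleMeasure.
Variable R : realType.
Notation circ := (circle R).
Notation arc := (@arclength R).

Lemma conjCE (z : R[i]) : z^*%R = z^*%C.
Proof. by []. Qed.

Lemma normc_circle (y : circ) : normc (circle_val y) = 1.
Proof.
have : `|circle_val y| = 1 by exact: (set_mem (valP y)).
by rewrite normc_def; case: (circle_val y) => a b [].
Qed.

Lemma continuous_circle_measurable (f : set_type (@unit_circle R) -> R) :
  continuous f -> measurable_fun [set: circ] (f : circ -> R).
Proof.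
move=> cf; apply: (@measurability _ _ _ _ _ _ (@RGenOpens.G R)).
  exact: RGenOpens.measurableE.
move=> _ [_ [a [b ->]] <-]; rewrite setTI; apply: sub_sigma_algebra.
by move/continuousP : cf; apply; exact: interval_open.
Qed.

Lemma continuous_part_circle (f : R[i] -> R) :
  {morph f : x y / x - y} -> (forall x, `|f x| <= normc x) ->
  continuous (fun y : set_type (@unit_circle R) => f (set_val y)).
Proof.
move=> fB fle.
have cf : continuous (f : R[i]^o -> R).
  move=> v; apply/(@cvgrPdist_lt _ R _ (nbhs (v : R[i]^o)) (nbhs_filter (v : R[i]^o))) => e e0.
  have e0C : 0 < e%:C by rewrite ltcR.
  have := nbhsx_ballx (v : R[i]^o) _ e0C.
  apply: filterS => u; rewrite -ball_normE/= => vu.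
  rewrite -fB (le_lt_trans (fle _))//.
  by move: vu; rewrite normc_def ltcR; case: (_ - _).
move=> y; apply: (@continuous_comp _ R[i]^o R set_val f); last exact: cf.
exact: initial_continuous.
Qed.

Lemma norm_Re_le (x : R[i]) : `|complex.Re x| <= normc x.
Proof. by case: x => a b /=; rewrite -sqrtr_sqr ler_wsqrtr// lerDl sqr_ge0. Qed.

Lemma norm_Im_le (x : R[i]) : `|complex.Im x| <= normc x.
Proof. by case: x => a b /=; rewrite -sqrtr_sqr ler_wsqrtr// lerDr sqr_ge0. Qed.

Lemma bmc_circle_val : bmc (@circle_val R).
Proof.
split; split.
- apply: (@continuous_circle_measurable (fun y => complex.Re (set_val y))).
  by apply: continuous_part_circle norm_Re_le => x y; rewrite raddfB.
- by exists 1 => y; rewrite -(normc_circle y) norm_Re_le.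
- apply: (@continuous_circle_measurable (fun y => complex.Im (set_val y))).
  by apply: continuous_part_circle norm_Im_le => x y; rewrite raddfB.
- by exists 1 => y; rewrite -(normc_circle y) norm_Im_le.
Qed.

Lemma bmc_poly (p : {poly R[i]}) : bmc (fun y : circ => p.[circle_val y]).
Proof. exact/bmc_horner/bmc_circle_val. Qed.

Lemma circle_mul_conj (y : circ) : circle_val y * (circle_val y)^*%C = 1.
Proof.
have := normc_circle y; case: (circle_val y) => a b /= /(congr1 (fun x => x ^+ 2)).
rewrite expr1n sqr_sqrtr ?addr_ge0 ?sqr_ge0// => ab.
by apply: complex_eq; rewrite ?ReM ?ImM/= -?ab; ring.
Qed.

Lemma circle_val_neq0 (y : circ) : circle_val y != 0.
Proof.
apply/eqP => y0; have := circle_mul_conj y; rewrite y0 mul0r => /eqP.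
by rewrite eq_sym oner_eq0.
Qed.

Lemma conj_circle (y : circ) : (circle_val y)^*%C = (circle_val y)^-1.
Proof. by apply: (mulfI (circle_val_neq0 y)); rewrite circle_mul_conj mulfV// circle_val_neq0. Qed.

Lemma pstar_circle (g : {poly R[i]}) (y : circ) :
  pstar g (circle_val y) = (g.[circle_val y])^*%C.
Proof. by rewrite /pstar conj_circle invrK. Qed.

Lemma ipE mu f g : ip mu f g =
  cm_integral mu (fun y : circ => f.[circle_val y] * (g.[circle_val y])^*%C).
Proof. by congr cm_integral; apply/funext => y; rewrite pstar_circle. Qed.

Lemma bmc_ip (f g : {poly R[i]}) :
  bmc (fun y : circ => f.[circle_val y] * (g.[circle_val y])^*%C).
Proof. by apply: bmcM; [|apply: bmc_conj]; exact: bmc_poly. Qed.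

Lemma toeplitz_form_ip mu : toeplitz_form (@ip R mu).
Proof.
split.
- move=> f g p; rewrite !ipE -cm_integralD; [|exact: bmc_ip..].
  by congr cm_integral; apply/funext => y; rewrite hornerD mulrDl.
- move=> c f p; rewrite !ipE -cm_integralZ; last exact: bmc_ip.
  by congr cm_integral; apply/funext => y; rewrite hornerZ mulrA.
- move=> f g p; rewrite !ipE -cm_integralD; [|exact: bmc_ip..].
  by congr cm_integral; apply/funext => y; rewrite hornerD rmorphD mulrDr.
- move=> c f p; rewrite !ipE -cm_integralZ; last exact: bmc_ip.
  by congr cm_integral; apply/funext => y; rewrite hornerZ rmorphM mulrCA.
- move=> f g; rewrite !ipE; congr cm_integral; apply/funext => y.
  by rewrite !hornerM hornerX rmorphM mulrACA circle_mul_conj mul1r.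
- move=> n f g sf sg; rewrite !ipE; congr cm_integral; apply/funext => y.
  have yE : ((circle_val y)^*%R)^-1 = circle_val y by rewrite conjCE conj_circle invrK.
  rewrite !horner_revp ?circle_val_neq0// yE !conjCE rmorphM/= conjcK mulrACA.
  by rewrite rmorphXn/= -exprMn circle_mul_conj expr1n mul1r mulrC.
Qed.

Notation leb := (@lebesgue_measure R).

Lemma bmf_cis (h : circ -> R) : bmf h -> bmf (fun t : measurableTypeR R => h (cis t)).
Proof.
move=> [mh [M hM]]; split; last by exists M.
by apply: measurableT_comp => //; exact: measurable_cis.
Qed.

Lemma integral_arclength (h : circ -> R) : bmf h ->
  \int[arc]_y h y = \int[leb]_(t in `[0, 2 * pi]) h (cis t).
Proof.
move=> bh; have [mhc [M hcM]] := bmf_cis bh.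
rewrite /Rintegral -integral_itv_bndo_bndc; last first.
  by apply/measurable_EFinP; exact: measurable_funTS.
pose D : set (measurableTypeR R) := `[0, 2 * pi[%classic.
have mD : measurable D by exact: measurable_itv.
pose m' := mrestr leb (measurable_itv `[0%R, 2 * pi[) : {measure set (measurableTypeR R) -> \bar R}.
have m'fin : (m' setT < +oo)%E.
  rewrite /m' /= /mrestr setTI lebesgue_measure_itv/=.
  by case: ifP => _; rewrite -?EFinD ltry.
have im' : m'.-integrable setT (EFin \o (fun t => h (cis t))).
  apply: measurable_bounded_integrable => //.
  exists M; split; first exact: num_real.
  by move=> N MN x _; rewrite /= (le_trans (hcM _))// ltW.
congr fine.
transitivity (\int[pushforward m' (@cis R)]_y (h y)%:E)%E.
  by apply: eq_measure_integral; [exact: measurable_cis|move=> mc A mA _].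
rewrite integral_pushforward//.
- rewrite preimage_setT.
  rewrite (@negligible_integral _ _ _ m' setT (~` D))//; last 2 first.
  + exact: measurableC.
  + by rewrite /m' /= /mrestr setICl measure0.
  rewrite setTD setCK; apply: eq_measure_integral => A mA AD.
  by rewrite /m' /= /mrestr; congr (_ _); exact/setIidPl.
- exact: measurable_cis.
- by apply/measurable_EFinP; case: bh.
Qed.

Lemma integral_periodic_derivative (f F : R -> R) (b : R) : 0 < b ->
  continuous f -> (forall x : R, is_derive x (1 : R) F (f x)) -> F b = F 0 ->
  \int[leb]_(t in `[0, b]) f t = 0.
Proof.
move=> b0 cf dF Fb.
have cF x : {for x, continuous F}.
  by apply: differentiable_continuous; apply/derivable1_diffP; exact: (@ex_derive _ _ _ _ _ _ _ (dF x)).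
rewrite /Rintegral (@continuous_FTC2 _ f F)//.
- by rewrite Fb -EFinB subrr.
- exact: continuous_subspaceT.
- split.
  + by move=> x _; exact: (@ex_derive _ _ _ _ _ _ _ (dF x)).
  + by apply: cvg_at_right_filter; exact: cF.
  + by apply: cvg_at_left_filter; exact: cF.
- by move=> x _; rewrite derive1E; exact: (@derive_val _ _ _ _ _ _ _ (dF x)).
Qed.

Lemma cis_exp (t : R) k :
  (circle_val (cis t : circ)) ^+ k = cos (k%:R * t) +i* sin (k%:R * t).
Proof.
elim: k => [|k ih]; first by rewrite expr0 mul0r cos0 sin0.
rewrite exprSr ih -natr1 mulrDl mul1r cosD sinD.
by apply: complex_eq; rewrite ?ReM ?ImM/=; ring.
Qed.

Lemma cos_sin_multiple (k : nat) :
  cos (k%:R * (2 * pi)) = 1 :> R /\ sin (k%:R * (2 * pi)) = 0 :> R.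
Proof.
have := cis_exp (2 * pi) k.
have -> : circle_val (cis (2 * pi) : circ) = 1.
  by apply: complex_eq => /=; rewrite mulr_natl ?cos2pi ?sin2pi.
by rewrite expr1n => -[<- <-].
Qed.

Lemma arclength_moment k : (0 < k)%N ->
  \int[arc]_y complex.Re (circle_val y ^+ k) = 0 /\
  \int[arc]_y complex.Im (circle_val y ^+ k) = 0.
Proof.
move=> k0; have [bR bI] := bmcX k bmc_circle_val.
have kR : k%:R != 0 :> R by rewrite pnatr_eq0 -lt0n.
have pi20 : 0 < 2 * pi :> R by rewrite mulr_gt0// pi_gt0.
have [ck sk] := cos_sin_multiple k.
have cm (x : R) : {for x, continuous (fun t : R => k%:R * t)}.
  by apply: continuousM; [exact: cst_continuous|exact: cvg_id].
have dk (x : R) : is_derive x (1 : R) (fun t : R => k%:R * t) k%:R.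
  have -> : (fun t : R => k%:R * t) = k%:R *: (@id R) by [].
  by apply: is_derive_eq; rewrite /GRing.scale/= mulr1.
split; rewrite integral_arclength//; under eq_Rintegral do rewrite cis_exp/=.
- apply: (@integral_periodic_derivative _ (k%:R^-1 *: (sin \o (fun t => k%:R * t)))) => //.
  + by move=> x; apply: continuous_comp; [exact: cm|exact: continuous_cos].
  + move=> x; apply: is_derive_eq.
    by rewrite /GRing.scale/= mulrCA mulVf// mulr1.
  + change (k%:R^-1 * sin (k%:R * (2 * pi)) = k%:R^-1 * sin (k%:R * 0) :> R).
    by rewrite sk !mulr0 sin0 mulr0.
- apply: (@integral_periodic_derivative _ (- k%:R^-1 *: (cos \o (fun t => k%:R * t)))) => //.
  + by move=> x; apply: continuous_comp; [exact: cm|exact: continuous_sin].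
  + move=> x; apply: is_derive_eq.
    by rewrite /GRing.scale/= [_ * k%:R]mulNr mulrNN mulrCA mulVf// mulr1.
  + change (- k%:R^-1 * cos (k%:R * (2 * pi)) = - k%:R^-1 * cos (k%:R * 0) :> R).
    by rewrite ck mulr0 cos0.
Qed.
End CircleMeasure.

(** * The kernels *)

Section ArclengthForm.
Variable R : realType.
Notation arc := (@arclength R).
Implicit Types (f : {poly R[i]}).

Definition arc_integral (g : circle R -> R[i]) : R[i] :=
  (\int[arc]_y complex.Re (g y)) +i* (\int[arc]_y complex.Im (g y)).

Definition arc_cm : complex_measure (circle R) R :=
  cm_scale 1 (charge_of_finite_measure arc).

Lemma cm_integral_arc g : bmc g -> cm_integral arc_cm g = arc_integral g.
Proof.
move=> [g1 g2]; set mc := charge_of_finite_measure arc.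
have H1 h : bmf h -> charge_integral (cscale 1 mc) h = \int[arc]_y h y.
  move=> bh; rewrite -charge_integral_measure//.
  rewrite (@charge_integral_comb _ _ _ _ mc mc 0) ?mul0r ?addr0//.
  by move=> A mA; rewrite mul0r addr0; congr fine; exact: mul1e.
have H0 h : bmf h -> charge_integral (cscale 0 mc) h = 0.
  move=> bh; rewrite (@charge_integral_comb _ _ _ _ mc mc (-1)) ?mulN1r ?subrr//.
  by move=> A mA; rewrite mulN1r subrr; exact: (congr1 fine (mul0e _)).
apply: complex_eq; rewrite /cm_integral /arc_cm /cm_scale/= !H1// !H0//.
  by rewrite subr0.
by rewrite addr0.
Qed.

Lemma arc_form_moment i j :
  ip arc_cm 'X^i 'X^j = if i == j then (2 * pi)%:C else 0.
Proof.
have tA := toeplitz_form_ip arc_cm.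
have tX a b k : ip arc_cm ('X^(a + k)) ('X^(b + k)) = ip arc_cm 'X^a 'X^b.
  elim: k => [|k ih]; first by rewrite !addn0.
  by rewrite !addnS !exprS (tfX tA).
have bX k : bmc (fun y : circle R => circle_val y ^+ k) by apply/bmcX/bmc_circle_val.
have ipX k : ip arc_cm 'X^k 1 = arc_integral (fun y => circle_val y ^+ k).
  rewrite ipE -cm_integral_arc//; congr cm_integral; apply/funext => y.
  by rewrite hornerXn hornerC conjc1 mulr1.
have ipX1 k : ip arc_cm 1 'X^k = (ip arc_cm 'X^k 1)^*%C.
  have -> : ip arc_cm 1 'X^k = arc_integral (fun y => (circle_val y ^+ k)^*%C).
    rewrite ipE -cm_integral_arc; last exact/bmc_conj.
    by congr cm_integral; apply/funext => y; rewrite hornerXn hornerC mul1r.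
  rewrite ipX; apply: complex_eq => /=.
    by congr Rintegral; apply/funext => y; case: (_ ^+ _).
  rewrite -mulN1r -(bfunZ (bounded_functional_Rintegral _)); last by have [] := bX k.
  by congr Rintegral; apply/funext => y; case: (_ ^+ _) => a b /=; rewrite mulN1r.
have ip0 k : (0 < k)%N -> ip arc_cm 'X^k 1 = 0.
  by move=> k0; rewrite ipX /arc_integral; have [-> ->] := arclength_moment R k0.
have tXl k l : ip arc_cm ('X^(k + l)) ('X^l) = ip arc_cm 'X^k 1.
  by rewrite -{2}[l]add0n tX expr0.
have tXr k l : ip arc_cm 'X^l ('X^(k + l)) = ip arc_cm 1 'X^k.
  by rewrite -{1}[l]add0n tX expr0.
case: (ltngtP i j) => [ij|ij|->].
- by rewrite -(subnK (ltnW ij)) tXr ipX1 ip0 ?conjc0// subn_gt0.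
- by rewrite -(subnK (ltnW ij)) tXl ip0// subn_gt0.
- rewrite -[j]add0n tXl ipX /arc_integral; apply: complex_eq => /=.
    by rewrite Rintegral_cst// mul1r; exact: (congr1 fine (arclengthT R)).
  by rewrite Rintegral_cst// mul0r.
Qed.

Lemma arc_form_horner n f (x : R[i]) : (size f <= n.+1)%N ->
  ip arc_cm f (\poly_(j < n.+1) (x^*%C) ^+ j) = (2 * pi)%:C * f.[x].
Proof.
move=> sf; have tA := toeplitz_form_ip arc_cm.
rewrite (horner_coef_wide _ sf) mulr_sumr poly_def.
have {1}-> : f = \sum_(i < n.+1) f`_i *: 'X^i.
  rewrite -poly_def; apply/polyP => k; rewrite coef_poly; case: ltnP => // nk.
  by rewrite nth_default// (leq_trans sf).
rewrite (tf_sum tA); apply: eq_bigr => i _; rewrite (tfZ tA) (tf_sumr tA).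
rewrite (bigD1 i)//= (tfZr tA) arc_form_moment eqxx big1 ?addr0.
  by rewrite rmorphXn/= conjCE conjcK; ring.
move=> j ji; rewrite (tfZr tA) arc_form_moment -[_ == _ :> nat]/(i == j) eq_sym (negbTE ji) mulr0//.
Qed.
End ArclengthForm.

Section SU2Class.
Variable R : realType.
Variable mu : complex_measure (circle R) R.
Hypothesis muT : class_Tminus mu.

Notation B := (ip mu).
Notation P := (Phi mu).
Notation Q := (tPhi mu).
Notation a := (coefF mu).

Let tB : toeplitz_form B. Proof. exact: toeplitz_form_ip. Qed.

Lemma Phi_mop n : lmop B n (P n).
Proof.
have [[_ /(_ n)[[p [hp _]] _]] _] := muT.
exact: (@xgetPex _ 0 [set P | left_mop mu n P] (ex_intro _ p hp)).
Qed.

Lemma tPhi_mop n : rmop B n (Q n).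
Proof.
have [[_ /(_ n)[_ [p [hp _]]]] _] := muT.
exact: (@xgetPex _ 0 [set P | right_mop mu n P] (ex_intro _ p hp)).
Qed.

Lemma Phi_uniq n p : lmop B n p -> P n = p.
Proof.
have [[_ /(_ n)[[p0 [_ up]] _]] _] := muT.
by move=> hp; rewrite -(up _ (Phi_mop n)); exact: up.
Qed.

Lemma tPhi_uniq n p : rmop B n p -> Q n = p.
Proof.
have [[_ /(_ n)[_ [p0 [_ up]]]] _] := muT.
by move=> hp; rewrite -(up _ (tPhi_mop n)); exact: up.
Qed.

Lemma size_Phi n : size (P n) = n.+1. Proof. by have [] := Phi_mop n. Qed.
Lemma size_tPhi n : size (Q n) = n.+1. Proof. by have [] := tPhi_mop n. Qed.

Lemma monic_size1 (p : {poly R[i]}) : p \is monic -> size p = 1%N -> p = 1.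
Proof.
move=> /monicP mp sp; rewrite lead_coefE sp/= in mp.
by rewrite (size1_polyC (eq_leq sp)) mp.
Qed.

Lemma Phi0 : P 0 = 1.
Proof. by have [mP sP _] := Phi_mop 0; exact: monic_size1. Qed.

Lemma tPhi0 : Q 0 = 1.
Proof. by have [mP sP _] := tPhi_mop 0; exact: monic_size1. Qed.

Lemma szego_pointwise n (p1 p q : {poly R[i]}) c : (size q <= n.+1)%N ->
  (forall z, z != 0 -> p1.[z] - z * p.[z] = c^*%C * z ^+ n * pstar q z) <->
  p1 = 'X * p + c^*%R *: revp n q.
Proof.
move=> sq; split=> [H|-> z z0].
  apply: poly_eq_punctured => z z0; have := H z z0 => /eqP.
  rewrite subr_eq addrC => /eqP ->.
  by rewrite hornerD hornerM hornerX hornerZ horner_revp// mulrA.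
rewrite hornerD hornerM hornerX hornerZ horner_revp// mulrA.
by rewrite addrAC subrr add0r.
Qed.

Lemma PhiS n : P n.+1 = 'X * P n + (a n)^*%R *: revp n (Q n).
Proof.
have sQ := size_tPhi n; apply/szego_pointwise; first by rewrite sQ.
have [c Hc] := szego_recurrence tB (Phi_mop n) (Phi_mop n.+1) (tPhi_mop n) (@tPhi_uniq n).
apply: (@xgetPex _ 0 [set F | forall z, z != 0 ->
  (P n.+1).[z] - z * (P n).[z] = F^*%C * z ^+ n * pstar (Q n) z]).
by exists c; apply/(szego_pointwise _ _ _ (eq_leq sQ)).
Qed.

Lemma tPhiS n : Q n.+1 = 'X * Q n - (a n)^*%R *: revp n (P n).
Proof.
have sP := size_Phi n.
have -> : a n = - coeftF mu n by have [_] := muT; apply.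
rewrite rmorphN/= scaleNr opprK.
apply/szego_pointwise; first by rewrite sP.
have [||||c Hc] := @szego_recurrence _ _ (toeplitz_form_conj tB) n (Q n) (Q n.+1) (P n).
- exact/lmop_conj/tPhi_mop.
- exact/lmop_conj/tPhi_mop.
- exact/rmop_conj/Phi_mop.
- by move=> p /rmop_conj; exact: Phi_uniq.
apply: (@xgetPex _ 0 [set F | forall z, z != 0 ->
  (Q n.+1).[z] - z * (Q n).[z] = F^*%C * z ^+ n * pstar (P n) z]).
by exists c; apply/(szego_pointwise _ _ _ (eq_leq sP)).
Qed.

Lemma ip11 : B 1 1 = 1.
Proof.
rewrite ipE; have [[<- _] _] := muT.
rewrite -cm_integral_indic//; congr cm_integral; apply/funext => y.
by rewrite hornerC conjc1 mulr1 indicE mem_set.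
Qed.

Lemma ip_Phi_tPhi n : B (P n) (Q n) = snorm a n.
Proof.
apply: (form_PQ Phi0 tPhi0 _ _ PhiS tPhiS tB ip11 Phi_mop tPhi_mop) => k.
  by rewrite size_Phi.
by rewrite size_tPhi.
Qed.

Lemma kernelK_cdker n z l :
  kernelK mu n z l = cdker P Q a n z (l^*%C)^-1.
Proof.
apply: eq_bigr => j _; rewrite /pstar /ntphi /nphi !hornerZ ip_Phi_tPhi.
have h0 := snorm_gt0 a j; set h := snorm a j in h0 *.
have sh : sqrtC h * sqrtC h = h by rewrite -expr2 sqrtCK.
have cs : (sqrtC h)^*%R = sqrtC h by apply/CrealP; rewrite ger0_real// sqrtC_ge0 ltW.
rewrite -!conjCE rmorphM fmorphV/= cs mulrACA -invfM sh.
by [].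
Qed.

Lemma kernelK_kerp n z l :
  (kernelK mu n z l)^*%C = (kerp P Q a n z).[(l^*%C)^-1].
Proof. by rewrite kernelK_cdker horner_kerp. Qed.

Definition dker n (l : R[i]) : {poly R[i]} := \poly_(j < n.+1) (l^-1) ^+ j.

Lemma kernelD_dker n z l : kernelD n z l = (dker n l).[z].
Proof.
rewrite /dker horner_poly; apply: eq_bigr => j _.
by rewrite exprVn mulrC.
Qed.

Lemma kernel_difference (c : R[i]) n z l : l != 0 ->
  c^*%C * kernelK mu n z l - kernelD n z l =
  - (ip (cm_sub mu (cm_scale (c / (2 * pi)%:C)
       (charge_of_finite_measure (@arclength R)))) (kerp P Q a n z) (dker n l))^*%C.
Proof.
move=> l0.
have sk : (size (kerp P Q a n z) <= n.+1)%N.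
  by apply: size_kerp => k; rewrite ?size_Phi// size_tPhi.
rewrite ipE cm_integral_sub_scale; last exact: bmc_ip.
rewrite -/(arc_integral _) -cm_integral_arc; last exact: bmc_ip.
rewrite -!ipE; have dE : dker n l = \poly_(j < n.+1) ((((l^*%C)^-1)^*%C) ^+ j).
  by rewrite /dker -!conjCE fmorphV/= !conjCE conjcK.
rewrite {2}dE arc_form_horner// -kernelK_kerp kernelD_dker.
rewrite (form_kerp Phi0 tPhi0 _ _ PhiS tPhiS tB ip11 Phi_mop tPhi_mop)//; last first.
- exact: size_poly.
- by move=> k; rewrite size_tPhi.
- by move=> k; rewrite size_Phi.
rewrite mulrA divfK; last first.
  by rewrite eq_complex/= negb_and mulf_neq0// gt_eqF// pi_gt0.
by rewrite conjCE rmorphB rmorphM/= !conjcK opprB.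
Qed.

End SU2Class.

Section KernelBounds.
Variable R : realType.

Lemma normCE (x : R[i]) : `|x| = (normc x)%:C.
Proof. by rewrite normc_def; case: x. Qed.

Lemma normcB (x y : R[i]) : normc (x - y) = normc (y - x).
Proof. by rewrite -normcN opprB. Qed.

Section Kerp.
Variables (P Q : nat -> {poly R[i]}) (a : nat -> R[i]).
Hypothesis P0 : P 0 = 1.
Hypothesis Q0 : Q 0 = 1.
Hypothesis sP : forall n, (size (P n) <= n.+1)%N.
Hypothesis sQ : forall n, (size (Q n) <= n.+1)%N.
Hypothesis PS : forall n, P n.+1 = 'X * P n + (a n)^*%R *: revp n (Q n).
Hypothesis QS : forall n, Q n.+1 = 'X * Q n - (a n)^*%R *: revp n (P n).
Variables (n : nat) (z : R[i]) (m : R) (y : circle R).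
Hypotheses (m1 : 1 <= m) (zm : normc z <= m).

Let mC1 : 1 <= m%:C :> R[i]. Proof. by rewrite -[1]/(1%:C) lecR. Qed.
Let zmC : `|z| <= m%:C. Proof. by rewrite normCE lecR. Qed.
Let y1 : `|circle_val y| = 1. Proof. by rewrite normCE normc_circle. Qed.

Lemma kerp_le :
  normc (kerp P Q a n z).[circle_val y] <= 2 * n.+1%:R * m ^+ n.
Proof.
rewrite -lecR -normCE horner_kerp norm_conjC.
have := cdker_le P0 Q0 sP sQ PS QS n mC1 zmC y1.
by rewrite !rmorphM rmorphXn !rmorph_nat.
Qed.

Lemma kerp_dist_le :
  normc (circle_val y - z) * normc (kerp P Q a n z).[circle_val y] <= 4 * m ^+ n.+1.
Proof.
rewrite -lecR rmorphM/= -!normCE horner_kerp norm_conjC.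
have := cdker_dist_le P0 Q0 sP sQ PS QS n mC1 zmC y1.
by rewrite rmorphM rmorphXn rmorph_nat.
Qed.
End Kerp.

Section Dker.
Variables (n : nat) (l : R[i]) (r : R) (y : circle R).
Hypotheses (l0 : l != 0) (r1 : 1 <= r) (lr : (normc l)^-1 <= r).

Let rC1 : 1 <= r%:C :> R[i]. Proof. by rewrite -[1]/(1%:C) lecR. Qed.
Let r0 : 0 <= r%:C :> R[i]. Proof. exact: le_trans rC1. Qed.
Let q := l^-1 * circle_val y.
Let qr j : `|q ^+ j| <= r%:C ^+ j.
Proof.
rewrite normrX lerXn2r ?nnegrE//.
by rewrite normrM [`|circle_val y|]normCE normc_circle mulr1 normfV normCE -fmorphV lecR.
Qed.

Let dE : (dker n l).[circle_val y] = \sum_(j < n.+1) q ^+ j.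
Proof.
by rewrite /dker horner_poly; apply: eq_bigr => j _; rewrite exprMn.
Qed.

Lemma dker_le : normc (dker n l).[circle_val y] <= n.+1%:R * r ^+ n.
Proof.
rewrite -lecR -normCE dE rmorphM rmorphXn rmorph_nat/=.
rewrite (le_trans (ler_norm_sum _ _ _))//.
apply: (@le_trans _ _ (\sum_(j < n.+1) (r%:C ^+ n))).
  by apply: ler_sum => j _; rewrite (le_trans (qr _))// ler_weXn2l// -ltnS.
by rewrite sumr_const card_ord mulr_natl.
Qed.

Lemma dker_dist_le :
  normc (circle_val y - l) * normc (dker n l).[circle_val y] <= normc l + r ^+ n.
Proof.
rewrite -lecR rmorphM rmorphD rmorphXn/= -!normCE -normrM.
have -> : (circle_val y - l) * (dker n l).[circle_val y] = circle_val y * q ^+ n - l.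
  have -> : circle_val y - l = l * (q - 1).
    by rewrite mulrBr mulr1 /q mulrA divff// mul1r.
  rewrite dE -mulrA -subrX1 exprS mulrBr mulr1 /q; congr (_ - _).
  by rewrite !mulrA divff// mul1r.
rewrite [leRHS]addrC (le_trans (ler_normB _ _))// lerD2r normrM.
by rewrite [`|circle_val y|]normCE normc_circle mul1r.
Qed.
End Dker.
End KernelBounds.

Section RealBounds.
Variable R : realType.
Implicit Types (x C : R) (n : nat).

Lemma expr_le_expR x n : 0 <= x -> (1 + x) ^+ n <= expR (x * n%:R).
Proof.
move=> x0; rewrite expRM_natr lerXn2r ?nnegrE ?expR_ge0 ?addr_ge0//.
exact: expR_ge1Dx.
Qed.

Lemma kernel_product_bound n C (p q dz dl t N x E : R) :
  N = n%:R -> x = C / N -> E = expR C ->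
  2 <= C -> 2 * C <= N -> 0 <= p -> 0 <= q -> 0 <= dz -> 0 <= dl -> 0 <= t ->
  p <= 2 * (N + 1) * (1 + x) ^+ n -> dz * p <= 4 * (1 + x) ^+ n.+1 ->
  q <= (N + 1) * (1 + 2 * x) ^+ n -> dl * q <= (1 + x) + (1 + 2 * x) ^+ n ->
  t <= dz + x -> t <= dl + x ->
  p * q <= (N + 1) ^+ 2 * E ^+ 30 /\ p * q * t ^+ 2 <= E ^+ 30.
Proof.
move=> NE xE EE C2 CN p0 q0 dz0 dl0 t0 pN dzp qN dlq tdz tdl.
have N0 : 0 < N by lra.
have xN : x * N = C by rewrite xE divfK// gt_eqF.
have x0 : 0 <= x by rewrite xE divr_ge0// ltW//; lra.
have x2 : 2 * x <= 1 by rewrite -(ler_pM2r N0); lra.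
have EC : 1 + C <= E by rewrite EE expR_ge1Dx.
have ME : (1 + x) ^+ n <= E by rewrite EE -xN NE expr_le_expR.
have rE : (1 + 2 * x) ^+ n <= E ^+ 2.
  by rewrite EE -expRM_natl -xN mulrA NE expr_le_expR// mulr_ge0.
have MSE : (1 + x) ^+ n.+1 <= E ^+ 2.
  rewrite exprS expr2 ler_pM//; first by lra.
    by rewrite exprn_ge0//; lra.
  by lra.
have E3 : 3 <= E by lra.
have pE : p <= 2 * (N + 1) * E.
  by apply: le_trans pN _; rewrite ler_wpM2l//; lra.
have qE : q <= (N + 1) * E ^+ 2.
  by apply: le_trans qN _; rewrite ler_wpM2l//; lra.
have dzE : dz * p <= 4 * E ^+ 2 by lra.
have dlE : dl * q <= 2 * E ^+ 2.
  have E9 : 9 <= E ^+ 2 by rewrite expr2; nra.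
  by lra.
have pq : p * q <= 2 * (N + 1) ^+ 2 * E ^+ 3.
  have -> : 2 * (N + 1) ^+ 2 * E ^+ 3 = (2 * (N + 1) * E) * ((N + 1) * E ^+ 2) by ring.
  exact: ler_pM.
have E0 : 0 <= E by lra.
have E1 : 1 <= E by lra.
have powE k j : (k <= j)%N -> E ^+ k <= E ^+ j by move=> kj; rewrite ler_weXn2l.
split.
  apply: le_trans pq _; rewrite -mulrA mulrCA ler_wpM2l ?sqr_ge0//.
  apply: (@le_trans _ _ (E * E ^+ 3)); first by rewrite ler_wpM2r ?exprn_ge0//; lra.
  by rewrite -exprS powE.
have E16 : 32 <= E ^+ 4.
  have : 9 <= E ^+ 2 by rewrite expr2; nra.
  have -> : E ^+ 4 = E ^+ 2 * E ^+ 2 by ring.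
  nra.
have [tx|tx] := leP (2 * x) t.
- have h1 : t * p <= 8 * E ^+ 2 by nra.
  have h2 : t * q <= 4 * E ^+ 2 by nra.
  have -> : p * q * t ^+ 2 = (t * p) * (t * q) by ring.
  apply: (@le_trans _ _ ((8 * E ^+ 2) * (4 * E ^+ 2))).
    by apply: ler_pM => //; rewrite mulr_ge0.
  have -> : 8 * E ^+ 2 * (4 * E ^+ 2) = 32 * E ^+ 4 by ring.
  apply: (@le_trans _ _ (E ^+ 4 * E ^+ 4)); first by rewrite ler_wpM2r ?exprn_ge0.
  by rewrite -exprD powE.
- have tt : t ^+ 2 <= (2 * x) ^+ 2 by rewrite lerXn2r ?nnegrE ?mulr_ge0// ltW.
  apply: (@le_trans _ _ ((2 * (N + 1) ^+ 2 * E ^+ 3) * (2 * x) ^+ 2)).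
    by apply: ler_pM => //; rewrite ?mulr_ge0 ?sqr_ge0.
  have Nx : (N + 1) * x <= 2 * C.
    by rewrite mulrDl mul1r [N * x]mulrC xN; nra.
  have Nx0 : 0 <= (N + 1) * x by rewrite mulr_ge0//; lra.
  have -> : 2 * (N + 1) ^+ 2 * E ^+ 3 * (2 * x) ^+ 2 = 8 * ((N + 1) * x) ^+ 2 * E ^+ 3 by ring.
  have h : ((N + 1) * x) ^+ 2 <= (2 * E) ^+ 2 by rewrite lerXn2r ?nnegrE ?mulr_ge0//; lra.
  apply: (@le_trans _ _ (8 * (2 * E) ^+ 2 * E ^+ 3)).
    by rewrite ler_wpM2r ?exprn_ge0// ler_wpM2l.
  have -> : 8 * (2 * E) ^+ 2 * E ^+ 3 = 32 * E ^+ 5 by ring.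
  apply: (@le_trans _ _ (E ^+ 4 * E ^+ 5)); first by rewrite ler_wpM2r ?exprn_ge0.
  by rewrite -exprD powE.
Qed.
End RealBounds.

Section MinKernel.
Variable R : realType.

Lemma normc_conj (x : R[i]) : normc x^*%C = normc x.
Proof. by case: x => a b /=; rewrite sqrrN. Qed.

Lemma mine_inv (k t : R) : 0 < k ->
  mine k%:E (k * t ^+ 2)%:E^-1%E =
  (k * Num.max 1 (k ^+ 2 * t ^+ 2) `^ (-1))%:E.
Proof.
move=> k0; have k2 : 0 < k ^+ 2 by rewrite exprn_gt0.
rewrite powR_inv1; last by rewrite le_max ler01.
rewrite inver mulf_eq0 gt_eqF//= sqrf_eq0.
have [->|t0] := eqVneq t 0.
  by rewrite expr0n/= !mulr0 max_l// invr1 mulr1 ?eqxx min_l// leey.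
have t2 : 0 < t ^+ 2 by rewrite exprn_even_gt0.
have kt : 0 < k * t ^+ 2 by exact: mulr_gt0.
rewrite -EFin_min; congr EFin.
have [h|h] := leP (k ^+ 2 * t ^+ 2) 1.
  rewrite invr1 mulr1 min_l//.
  by rewrite -[leRHS]mul1r ler_pdivlMr// mulrA -expr2.
rewrite min_r.
  by field; rewrite t0 gt_eqF.
by rewrite -[leLHS]mul1r ler_pdivrMr// mulrA -expr2 ltW.
Qed.

Lemma le_mine_inv (k t M u : R) : 0 < k -> 0 < M -> u <= k ^+ 2 * M -> u * t ^+ 2 <= M ->
  (((k * M)^-1 * u)%:E <= mine k%:E (k * t ^+ 2)%:E^-1)%E.
Proof.
move=> k0 M0 u1 u2; rewrite le_min; apply/andP; split.
  by rewrite lee_fin ler_pdivrMl ?mulr_gt0// mulrAC -expr2.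
rewrite inver; case: eqP => [_|/eqP]; first exact: leey.
rewrite mulf_eq0 gt_eqF//= sqrf_eq0 => t0.
have t2 : 0 < t ^+ 2 by rewrite exprn_even_gt0.
have kt : 0 < k * t ^+ 2 by exact: mulr_gt0.
rewrite lee_fin ler_pdivrMl ?mulr_gt0// invfM.
by rewrite [k * M * _]mulrACA divff ?gt_eqF// mul1r ler_pdivlMr.
Qed.

End MinKernel.

Theorem theorem1 (R : realType) (mu mus : complex_measure (circle R) R)
  (w : circle R -> R[i]) (C : R) (s : circle R) (n : nat) (z lambda : R[i])
  (hmu : class_Tminus mu)
  (hw : lebesgue_decomposition mu (fun y => w y / (2 * pi)%:C) mus)
  (hC : 2 <= C)
  (hs : E_set (fun y => w y / (2 * pi)%:C) mus s)
  (hn : 2 * C <= n%:R)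
  (hz : normc (z - circle_val s) <= C / n%:R)
  (hlambda : normc (lambda - circle_val s) <= C / n%:R) :
  ((n.+1%:R^-1 *
      normc ((w s)^*%C * kernelK mu n z lambda - kernelD n z lambda))%:E
   <= (expR (30 * C))%:E * functionalL mu w s n)%E.
Proof.
set x := C / n%:R in hz hlambda.
have N0 : 0 < n%:R :> R by apply: lt_le_trans hn; lra.
have x0 : 0 <= x by rewrite divr_ge0// ?ltW//; lra.
have x2 : 2 * x <= 1.
  by rewrite -(ler_pM2r N0) /x mulrA divfK ?gt_eqF// mul1r.
have normc_s : normc (circle_val s) = 1 by exact: normc_circle.
have zx : normc z <= 1 + x.
  rewrite -[z](subrK (circle_val s)) (le_trans (le_normcD _ _))//.
  by rewrite normc_s addrC lerD2l.
have lx : normc lambda <= 1 + x.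
  rewrite -[lambda](subrK (circle_val s)) (le_trans (le_normcD _ _))//.
  by rewrite normc_s addrC lerD2l.
have lx' : 1 - x <= normc lambda.
  have := le_normcD (circle_val s - lambda) lambda.
  by rewrite subrK normc_s normcB; lra.
have l0 : lambda != 0.
  by apply/eqP => l0; move: lx'; rewrite l0 normc0; lra.
have lr : (normc lambda)^-1 <= 1 + 2 * x.
  have lpos : 0 < normc lambda by lra.
  rewrite -[_^-1]mul1r ler_pdivrMr//; nra.
rewrite kernel_difference// normcN normc_conj.
set nu := cm_sub _ _; set p := kerp _ _ _ _ _; set q := dker _ _.
pose b (y : circle R) : \bar R := mine n.+1%:R%:E
  (n.+1%:R * normc (circle_val y - circle_val s) ^+ 2)%:E^-1%E.
rewrite /functionalL -/nu -[X in (_ <= _ * X)%E]/(\int[cm_variation nu]_y b y)%E.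
pose u y := normc (p.[circle_val y] * (q.[circle_val y])^*%C).
have u_ge0 y : 0 <= u y by exact: normc_ge0.
have bu : bmc (fun y : circle R => p.[circle_val y] * (q.[circle_val y])^*%C) by exact: bmc_ip.
have meas_u : measurable_fun setT u by exact: measurable_normc.
pose E := expR (30 * C).
have EE : E = expR C ^+ 30 by rewrite /E expRM_natl.
have E0 : 0 < E by exact: expR_gt0.
have k0 : 0 < n.+1%:R :> R by [].
have ub y : (((n.+1%:R * E)^-1 * u y)%:E <= b y)%E.
  have PS := PhiS hmu; have QS := tPhiS hmu.
  have sP k : (size (Phi mu k) <= k.+1)%N by rewrite size_Phi.
  have sQ k : (size (tPhi mu k) <= k.+1)%N by rewrite size_tPhi.
  have x1 : 1 <= 1 + x by lra.
  have r1 : 1 <= 1 + 2 * x by lra.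
  have hp1 := kerp_le (Phi0 hmu) (tPhi0 hmu) sP sQ PS QS n y x1 zx.
  have hp2 := kerp_dist_le (Phi0 hmu) (tPhi0 hmu) sP sQ PS QS n y x1 zx.
  have hq1 := dker_le n y r1 lr.
  have hq2 := dker_dist_le n y l0 r1 lr.
  have tri v : normc (v - circle_val s) <= x ->
      normc (circle_val y - circle_val s) <= normc (circle_val y - v) + x.
    move=> vx; rewrite -[circle_val y](subrK v) -addrA (le_trans (le_normcD _ _))//.
    by rewrite subrK lerD2l.
  have [h1 h2] : normc p.[circle_val y] * normc q.[circle_val y] <=
        (n%:R + 1) ^+ 2 * expR C ^+ 30 /\
      normc p.[circle_val y] * normc q.[circle_val y] *
        normc (circle_val y - circle_val s) ^+ 2 <= expR C ^+ 30.
    apply: (@kernel_product_bound R n C _ _ (normc (circle_val y - z))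
      (normc (circle_val y - lambda)) _ n%:R x (expR C) erefl erefl erefl hC hn);
      try exact: normc_ge0; rewrite ?natr1//.
      by rewrite (le_trans hq2)// lerD2r.
    exact: tri.
  exact: tri.
  move: h1 h2; rewrite -EE natr1 => h1 h2.
  by apply: le_mine_inv; rewrite ?expR_gt0// /u normcM normc_conj.
have uE y : u y = n.+1%:R * E * ((n.+1%:R * E)^-1 * u y).
  by rewrite mulVKf// mulf_neq0// gt_eqF.
have bE : b = EFin \o (fun y => n.+1%:R * Num.max 1 (n.+1%:R ^+ 2 *
    normc (circle_val y - circle_val s) ^+ 2) `^ (-1)).
  by apply/funext => y; exact: mine_inv.
have mb : measurable_fun [set: circle R] b.
  rewrite bE; apply/measurable_EFinP.
  apply: measurable_funM => //.
  apply: (measurableT_comp (measurable_powR _)) => //.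
  apply: measurable_maxr => //.
  apply: measurable_funM => //.
  apply: measurable_funX; apply: measurable_normc.
  by apply: bmcD; [exact: bmc_circle_val|exact: bmc_cst].
rewrite EFinM lee_pdivrMl// ipE.
apply: (@le_trans _ _ (\int[cm_variation nu]_y (u y)%:E)%E).
  exact: (normc_cm_integral_le nu bu).
rewrite muleA -EFinM.
under eq_integral do rewrite uE EFinM.
have kE0 : 0 <= n.+1%:R * E by rewrite mulr_ge0// ltW.
have v_ge0 y : 0 <= (n.+1%:R * E)^-1 * u y by rewrite mulr_ge0// invr_ge0.
have mv : measurable_fun [set: circle R] (fun y => ((n.+1%:R * E)^-1 * u y)%:E).
  by apply/measurable_EFinP; exact: measurable_funM.
rewrite ge0_integralZl_EFin//; last by move=> y _; rewrite lee_fin.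
apply: lee_pmul => //.
  by apply: integral_ge0 => y _; rewrite lee_fin.
by apply: ge0_le_integral => // y _; rewrite lee_fin.
Qed.
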